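(* Let $X=(X(n))_{n\in\mathbb{Z}_+}$ be a standard subproduct system in the $C^*$-setting, and let $T$ be a fully coisometric, covariant representation of $X$ on a Hilbert space $\mathcal{H}$, satisfying $$\lim_{\ell\to\infty}\bigl\|(p_\ell\otimes I_{\mathcal{H}})(\eta\otimes\widetilde{T}_{\ell-m}^*h)\bigr\|_{X(\ell)\otimes_\sigma\mathcal{H}}=\|T_m(\eta)h\|_{\mathcal{H}}$$ for all $m\in\mathbb{N}$, $\eta\in X(m)$ and $h\in\mathcal{H}$. Then $T$ extends to a $C^*$-representation.
   Context: Conventions ($C^*$-setting). Hilbert spaces are complex; $C^*$-algebras need not be unital; all representations on Hilbert spaces are assumed nondegenerate. $\mathcal{M}$ is a $C^*$-algebra; a correspondence over $\mathcal{M}$ is a right Hilbert $C^*$-module $F$ over $\mathcal{M}$ (inner product $\langle\cdot,\cdot\rangle$ linear in the second variable) with a left action $a\zeta=\varphi(a)\zeta$ given by a $*$-homomorphism $\varphi:\mathcal{M}\to\mathcal{L}(F)$ into the adjointable operators; tensor products are interior tensor products. For a representation $\sigma$ of $\mathcal{M}$ on $\mathcal{H}$, $F\otimes_\sigma\mathcal{H}$ is the Hilbert space with $(\zeta_1\otimes h_1,\zeta_2\otimes h_2)=(h_1,\sigma(\langle\zeta_1,\zeta_2\rangle)h_2)$. Standard subproduct system: a family $X=(X(n))_{n\in\mathbb{Z}_+}$ of correspondences over $\mathcal{M}$ with $X(0)=\mathcal{M}$ such that $X(n+m)$ is an orthogonally complementable sub-bimodule of $X(n)\otimes X(m)$ for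 all $n,m$ (where $X(n)\otimes\mathcal{M}$ and $\mathcal{M}\otimes X(n)$ are identified with $X(n)$ via the module actions, so the left actions are nondegenerate). Put $E=X(1)$; then $X(n)\subseteq E^{\otimes n}$ ($E^{\otimes 0}=\mathcal{M}$), and $p_n\in\mathcal{L}(E^{\otimes n})$ is the orthogonal projection onto $X(n)$. Completely contractive, covariant representation of $X$ on $\mathcal{H}$: a family $T=(T_n)_{n\in\mathbb{Z}_+}$ of linear maps $T_n:X(n)\to B(\mathcal{H})$ such that $\sigma:=T_0$ is a $C^*$-representation of $\mathcal{M}$ on $\mathcal{H}$; each $T_n$ is completely contractive (with $X(n)$ viewed inside its linking algebra); $T_n(\zeta a)=T_n(\zeta)\sigma(a)$ and $T_n(a\zeta)=\sigma(a)T_n(\zeta)$; and $T_{n+m}(p_{n+m}(\zeta\otimes\eta))=T_n(\zeta)T_m(\eta)$ for $\zeta\in X(n),\eta\in X(m)$. For each $n$, $\widetilde{T}_n:X(n)\otimes_\sigma\mathcal{H}\to\mathcal{H}$ is the contraction $\widetilde{T}_n(\zeta\otimes h)=T_n(\zeta)h$. A fully coisometric, covariant representation is a completely contractive, covariant representation $T$ such that $\widetilde{T}_n$ is coisometric for all $n$. For $\ell\ge m$, $\eta\otimes\widetilde{T}_{\ell-m}^*h$ is an element of $X(m)\otimes X(\ell-m)\otimes_\sigma\mathcal{H}\subseteq E^{\otimes\ell}\otimes_\sigma\mathcal{H}$. $X$-Fock space and shift: $\mathcal{F}_X=\bigoplus_{n\in\mathbb{Z}_+}X(n)$, and for $\zeta\in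 X(n)$, $S_n(\zeta)\in\mathcal{L}(\mathcal{F}_X)$ is given by $S_n(\zeta)\eta=p_{n+m}(\zeta\otimes\eta)$ for $\eta\in X(m)$. The Toeplitz algebra $\mathcal{T}(X)$ is the $C^*$-subalgebra of $\mathcal{L}(\mathcal{F}_X)$ generated by all $S_n(\zeta)$, $n\in\mathbb{Z}_+$, $\zeta\in X(n)$. $T$ extends to a $C^*$-representation if there is a $C^*$-representation $\pi$ of $\mathcal{T}(X)$ on $\mathcal{H}$ with $\pi(S_n(\zeta))=T_n(\zeta)$ for all $n\in\mathbb{Z}_+$, $\zeta\in X(n)$. *)

(* Defs.v *)
From HB Require Import structures.
From mathcomp Require Import all_boot all_order all_algebra.
From mathcomp Require Import all_classical all_reals all_analysis.
From mathcomp Require Import complex.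

Set Implicit Arguments.
Unset Strict Implicit.
Unset Printing Implicit Defensive.

Import Order.TTheory GRing.Theory Num.Theory.
Import numFieldNormedType.Exports.

Local Open Scope classical_set_scope.
Local Open Scope ring_scope.

(* Norms of complex normed spaces take values in R[i]; the order of R[i] is
   partial, 0 <= z meaning that z is real and nonnegative. *)

Definition subspace (K : numFieldType) (V : normedModType K) (W : set V) :=
  W 0 /\ forall (c : K) x y, W x -> W y -> W (c *: x + y).

Definition closed_span (K : numFieldType) (V : normedModType K) (S : set V) :
    set V :=
  smallest [set W | subspace W /\ closed W] S.

Record hilbert (R : realType) := Hilbert {
  hilbert_car :> completeNormedModType R[i];
  dot : hilbert_car -> hilbert_car -> R[i];
  dot_linear : forall h (c : R[i]) g g',
    dot h (c *: g + g') = c * dot h g + dot h g';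
  dot_conj : forall h g, dot h g = (dot g h)^*;
  dot_norm : forall h, `|h| ^+ 2 = dot h h }.

Definition bounded_operator (R : realType) (H : hilbert R) (f : H -> H) :=
  linear f /\ continuous f.

Record cstar_algebra (R : realType) := CstarAlgebra {
  cstar_car :> completeNormedModType R[i];
  amul : cstar_car -> cstar_car -> cstar_car;
  astar : cstar_car -> cstar_car;
  amulA : forall a b c, amul a (amul b c) = amul (amul a b) c;
  amul_linearl : forall (k : R[i]) a b c,
    amul (k *: a + b) c = k *: amul a c + amul b c;
  amul_linearr : forall (k : R[i]) a b c,
    amul a (k *: b + c) = k *: amul a b + amul a c;
  astar_antilinear : forall (k : R[i]) a b,
    astar (k *: a + b) = k^* *: astar a + astar b;
  astarM : forall a b, astar (amul a b) = amul (astar b) (astar a);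
  astarK : forall a, astar (astar a) = a;
  amul_norm : forall a b, `|amul a b| <= `|a| * `|b|;
  cstar_identity : forall a, `|amul (astar a) a| = `|a| ^+ 2 }.

Record hilbert_module (R : realType) (M : cstar_algebra R) := HilbertModule {
  hmod_car :> completeNormedModType R[i];
  ract : hmod_car -> M -> hmod_car;
  ip : hmod_car -> hmod_car -> M;
  ract_linearl : forall (c : R[i]) x y a,
    ract (c *: x + y) a = c *: ract x a + ract y a;
  ract_linearr : forall (c : R[i]) x a b,
    ract x (c *: a + b) = c *: ract x a + ract x b;
  ractM : forall x a b, ract x (amul a b) = ract (ract x a) b;
  ip_linear : forall x (c : R[i]) y z, ip x (c *: y + z) = c *: ip x y + ip x z;
  ip_ract : forall x y a, ip x (ract y a) = amul (ip x y) a;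
  ip_star : forall x y, astar (ip x y) = ip y x;
  (* the positive elements of M are those of the form b^* b *)
  ip_ge0 : forall x, exists b : M, ip x x = amul (astar b) b;
  ip_norm : forall x, `|x| ^+ 2 = `|ip x x| }.

(* Between Hilbert modules a map having an adjoint is automatically linear and
   bounded, so L(F) is [set f | adjointable f]. *)
Definition adjoint_pair (R : realType) (M : cstar_algebra R)
    (F : hilbert_module M) (f g : F -> F) :=
  forall x y, ip (f x) y = ip x (g y).

Definition adjointable (R : realType) (M : cstar_algebra R)
    (F : hilbert_module M) (f : F -> F) :=
  exists g, adjoint_pair f g.

Record correspondence (R : realType) (M : cstar_algebra R) := Correspondence {
  corr_car :> hilbert_module M;
  lact : M -> corr_car -> corr_car;
  lact_linear : forall (c : R[i]) a b x,
    lact (c *: a + b) x = c *: lact a x + lact b x;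
  lactM : forall a b x, lact (amul a b) x = lact a (lact b x);
  lact_star : forall a, adjoint_pair (lact a) (lact (astar a)) }.

Section SelfCorrespondence.
Variables (R : realType) (M : cstar_algebra R).

Definition self_ip (a b : M) := amul (astar a) b.

Lemma self_ip_linear (x : M) (c : R[i]) (y z : M) :
  self_ip x (c *: y + z) = c *: self_ip x y + self_ip x z.
Proof. exact: amul_linearr. Qed.

Lemma self_ip_ract (x y a : M) : self_ip x (amul y a) = amul (self_ip x y) a.
Proof. exact: amulA. Qed.

Lemma self_ip_star (x y : M) : astar (self_ip x y) = self_ip y x.
Proof. by rewrite /self_ip astarM astarK. Qed.

Lemma self_ip_ge0 (x : M) : exists b : M, self_ip x x = amul (astar b) b.
Proof. by exists x. Qed.

Lemma self_ip_norm (x : M) : `|x| ^+ 2 = `|self_ip x x|.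
Proof. by rewrite /self_ip cstar_identity. Qed.

Definition self_module : hilbert_module M :=
  @HilbertModule R M M (@amul R M) self_ip
    (fun c x y a => amul_linearl c x y a) (fun c x a b => amul_linearr c x a b)
    (fun x a b => amulA x a b)
    self_ip_linear self_ip_ract self_ip_star self_ip_ge0 self_ip_norm.

Lemma self_lact_star (a : M) :
  @adjoint_pair R M self_module (amul a) (amul (astar a)).
Proof. by move=> x y; rewrite /= /self_ip astarM amulA. Qed.

Definition self_correspondence : correspondence M :=
  @Correspondence R M self_module (@amul R M)
    (fun c a b x => amul_linearl c a b x)
    (fun a b x => esym (amulA a b x)) self_lact_star.

End SelfCorrespondence.

(* t : F x G -> P exhibits P as the interior tensor product of F and G; this
   determines P up to a unique unitary bimodule map. *)
Record interior_tensor (R : realType) (M : cstar_algebra R)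
    (F G P : correspondence M) (t : F -> G -> P) : Prop := InteriorTensor {
  it_linearl : forall (c : R[i]) x x' y,
    t (c *: x + x') y = c *: t x y + t x' y;
  it_linearr : forall (c : R[i]) x y y',
    t x (c *: y + y') = c *: t x y + t x y';
  it_balanced : forall x a y, t (ract x a) y = t x (lact a y);
  it_lact : forall a x y, lact a (t x y) = t (lact a x) y;
  it_ract : forall x y a, ract (t x y) a = t x (ract y a);
  it_ip : forall x x' y y', ip (t x y) (t x' y') = ip y (lact (ip x x') y');
  it_dense : closed_span [set t x y | x in setT & y in setT] = setT }.

(* A sequence of correspondences whose 0-th term is M itself. *)
Definition unital_seq (R : realType) (M : cstar_algebra R)
    (E : nat -> correspondence M) (n : nat) : correspondence M :=
  if n is k.+1 then E k else self_correspondence M.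

(* The tensor powers E^{(x) n} of E := E^{(x) 1}, with E^{(x) 0} = M, together
   with the maps (x, y) |-> x (x) y which identify E^{(x) n} (x) E^{(x) m} with
   E^{(x) (n + m)}, associatively, and through the module actions when n = 0 or
   m = 0.  The target degree l is only constrained by n + m = l to avoid
   transporting along associativity of addition. *)
Record tensor_powers (R : realType) (M : cstar_algebra R) := TensorPowers {
  tpow_succ : nat -> correspondence M;
  tmul : forall n m l, (n + m)%N = l ->
    unital_seq tpow_succ n -> unital_seq tpow_succ m -> unital_seq tpow_succ l;
  tmul_tensor : forall n m l (e : (n + m)%N = l), interior_tensor (tmul e);
  tmul0l : forall n (e : (0 + n)%N = n) (a : M) (x : unital_seq tpow_succ n),
    tmul e (a : unital_seq tpow_succ 0) x = lact a x;
  tmul0r : forall n (e : (n + 0)%N = n) (x : unital_seq tpow_succ n) (a : M),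
    tmul e x (a : unital_seq tpow_succ 0) = ract x a;
  tmulA : forall n m k nm mk l (e1 : (n + m)%N = nm) (e2 : (nm + k)%N = l)
      (e3 : (m + k)%N = mk) (e4 : (n + mk)%N = l) x y z,
    tmul e2 (tmul e1 x y) z = tmul e4 x (tmul e3 y z) }.

Definition tpow (R : realType) (M : cstar_algebra R) (E : tensor_powers M)
    (n : nat) : correspondence M :=
  unital_seq (tpow_succ E) n.
Coercion tpow : tensor_powers >-> Funclass.

Section SubproductSystem.
Variables (R : realType) (M : cstar_algebra R) (E : tensor_powers M).

Definition tens n m (x : E n) (y : E m) : E (n + m)%N := tmul erefl x y.

Definition sub_bimodule (F : correspondence M) (W : set F) :=
  [/\ subspace W, closed W,
      forall x a, W x -> W (ract x a)
    & forall a x, W x -> W (lact a x)].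

Definition ortho_complementable (F : hilbert_module M) (W V : set F) :=
  W `<=` V /\
  forall v, V v -> exists w w', [/\ W w, V w', v = w + w'
                                  & forall u, W u -> ip u w' = 0].

Variable X : forall n, set (E n).

(* X(n) (x) X(m), as a submodule of E^{(x) (n + m)} *)
Definition sub_tensor n m : set (E (n + m)%N) :=
  closed_span [set tens x y | x in @X n & y in @X m].

Definition standard_subproduct_system :=
  [/\ @X 0%N = setT, @X 1%N = setT, forall n, sub_bimodule (@X n)
    & forall n m, ortho_complementable (@X (n + m)%N) (@sub_tensor n m)].

Definition ortho_projection (F : hilbert_module M) (W : set F) (p : F -> F) :=
  forall x, W (p x) /\ forall u, W u -> ip u (x - p x) = 0.

Variable p : forall n, E n -> E n.

(* F, with the coordinate maps co n, is the Hilbert module direct sum of the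
   X(n): the families z with z n in X(n) and \sum_n <z n, z n> norm convergent
   in M, with the inner product \sum_n <x n, y n>. *)
Record fock_space (F : hilbert_module M) (co : forall n, F -> E n) : Prop :=
  FockSpace {
  fock_linear : forall n (c : R[i]) x y,
    co n (c *: x + y) = c *: co n x + co n y;
  fock_ract : forall n x a, co n (ract x a) = ract (co n x) a;
  fock_mem : forall n x, X (co n x);
  fock_ip : forall x y,
    series (fun n => ip (co n x) (co n y)) @ \oo --> ip x y;
  fock_surj : forall z : forall n, E n, (forall n, X (z n)) ->
    cvg (series (fun n => ip (z n) (z n)) @ \oo) ->
    exists x, forall n, co n x = z n }.

(* x is the element y of the summand X(m) of the Fock space *)
Definition in_summand (F : hilbert_module M) (co : forall n, F -> E n)
    m (y : E m) (x : F) :=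
  co m x = y /\ forall k, k <> m -> co k x = 0.

Definition fock_shift (F : hilbert_module M) (co : forall n, F -> E n)
    (S : forall n, E n -> F -> F) :=
  forall n (z : E n), X z ->
    adjointable (S n z) /\
    forall m (y : E m) x, X y -> in_summand co y x ->
      in_summand co (p (tens z y)) (S n z x).

Definition cstar_subalgebra (F : hilbert_module M) (W : set (F -> F)) :=
  [/\ W `<=` [set f | adjointable f] /\ W (fun=> 0),
      forall (c : R[i]) f g, W f -> W g -> W (fun x => c *: f x + g x),
      forall f g, W f -> W g -> W (f \o g),
      forall f g, W f -> adjoint_pair f g -> W g
    & forall f, adjointable f ->
        (forall e : R[i], 0 < e ->
           exists2 g, W g & forall x, `|f x - g x| <= e * `|x|) ->
        W f].

Definition toeplitz_algebra (F : hilbert_module M)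
    (S : forall n, E n -> F -> F) : set (F -> F) :=
  smallest [set W | cstar_subalgebra W]
    [set f | exists n (z : E n), X z /\ f = S n z].

End SubproductSystem.

(* pi is a nondegenerate *-homomorphism into B(H) from the *-algebra with
   carrier D and the given operations; adj a b means that b = a^*. *)
Record star_representation (R : realType) (H : hilbert R) (A : Type) (D : set A)
    (add : A -> A -> A) (scale : R[i] -> A -> A) (mul : A -> A -> A)
    (adj : A -> A -> Prop) (pi : A -> H -> H) : Prop := StarRepresentation {
  rep_bounded : forall a, D a -> bounded_operator (pi a);
  rep_linear : forall c a b h, D a -> D b ->
    pi (add (scale c a) b) h = c *: pi a h + pi b h;
  rep_mul : forall a b h, D a -> D b -> pi (mul a b) h = pi a (pi b h);
  rep_star : forall a b h g, D a -> D b -> adj a b ->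
    dot (pi b h) g = dot h (pi a g);
  rep_nondegenerate : closed_span [set pi a h | a in D & h in setT] = setT }.

Definition representation (R : realType) (M : cstar_algebra R) (H : hilbert R)
    (sigma : M -> H -> H) :=
  star_representation [set: M] +%R *:%R (@amul R M)
    (fun a b => b = astar a) sigma.

Definition operator_representation (R : realType) (M : cstar_algebra R)
    (F : hilbert_module M) (D : set (F -> F)) (H : hilbert R)
    (pi : (F -> F) -> H -> H) :=
  star_representation D (fun f g x => f x + g x) (fun c f x => c *: f x)
    (fun f g => f \o g) (@adjoint_pair R M F) pi.

Section Representations.
Variables (R : realType) (M : cstar_algebra R) (H : hilbert R).

(* The norm of x in M_k(W), as a matrix over the linking algebra, is <= c.  The
   linking algebra acts faithfully on W (+) M, the corner element x in W sending
   (y, a) to (x a, 0), so this is the norm of the operator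
   (y_j, a_j)_j |-> (\sum_j x_ij a_j, 0)_i on (W (+) M)^k. *)
Definition linking_norm_le (F : hilbert_module M) (W : set F) k (x : 'M[F]_k)
    (c : R[i]) :=
  forall (y : 'I_k -> F) (a : 'I_k -> M), (forall j, W (y j)) ->
    `|\sum_i ip (\sum_j ract (x i j) (a j)) (\sum_j ract (x i j) (a j))| <=
    c ^+ 2 * `|\sum_j (ip (y j) (y j) + amul (astar (a j)) (a j))|.

(* The norm of the matrix b in M_k(B(H)) = B(H^k) is <= c. *)
Definition operator_norm_le k (b : 'I_k -> 'I_k -> H -> H) (c : R[i]) :=
  forall h : 'I_k -> H,
    \sum_i `|\sum_j b i j (h j)| ^+ 2 <= c ^+ 2 * \sum_j `|h j| ^+ 2.

Definition completely_contractive (F : hilbert_module M) (W : set F)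
    (T : F -> H -> H) :=
  forall k (x : 'M[F]_k) (c : R[i]), 0 <= c -> (forall i j, W (x i j)) ->
    linking_norm_le W x c -> operator_norm_le (fun i j => T (x i j)) c.

Variables (E : tensor_powers M) (X : forall n, set (E n)).
Variable (p : forall n, E n -> E n).

(* T n is only relevant on X(n). *)
Record cc_covariant_representation (T : forall n, E n -> H -> H) : Prop :=
  CCCovariantRepresentation {
  cc_rep : representation (T 0%N : M -> H -> H);
  cc_bounded : forall n (x : E n), X x -> bounded_operator (T n x);
  cc_linear : forall n (c : R[i]) (x y : E n) h, X x -> X y ->
    T n (c *: x + y) h = c *: T n x h + T n y h;
  cc_contractive : forall n, completely_contractive (@X n) (T n);
  cc_ract : forall n (x : E n) (a : M) h, X x ->
    T n (ract x a) h = T n x ((T 0%N : M -> H -> H) a h);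
  cc_lact : forall n (a : M) (x : E n) h, X x ->
    T n (lact a x) h = (T 0%N : M -> H -> H) a (T n x h);
  cc_mul : forall n m (x : E n) (y : E m) h, X x -> X y ->
    T (n + m)%N (p (tens x y)) h = T n x (T m y h) }.

Variable sigma : M -> H -> H.

(* The Hilbert spaces E^{(x) n} (x)_sigma H, with elementary tensors htens, and
   the maps hmul : E^{(x) m} x (E^{(x) k} (x)_sigma H) -> E^{(x) (m + k)}
   (x)_sigma H given by tensoring on the left. *)
Record hilbert_tensors := HilbertTensors {
  ht :> nat -> hilbert R;
  htens : forall n, E n -> H -> ht n;
  htens_linearl : forall n (c : R[i]) x x' h,
    @htens n (c *: x + x') h = c *: htens x h + htens x' h;
  htens_linearr : forall n (c : R[i]) x h h',
    @htens n x (c *: h + h') = c *: htens x h + htens x h';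
  htens_balanced : forall n x a h, @htens n (ract x a) h = htens x (sigma a h);
  htens_dot : forall n (x y : E n) h g,
    dot (htens x h) (htens y g) = dot h (sigma (ip x y) g);
  htens_dense : forall n,
    closed_span [set @htens n x h | x in setT & h in setT] = setT;
  hmul : forall m k, E m -> ht k -> ht (m + k)%N;
  hmul_linear : forall m k (x : E m), linear (@hmul m k x);
  hmul_continuous : forall m k (x : E m), continuous (@hmul m k x);
  hmul_htens : forall m k (x : E m) (y : E k) h,
    hmul x (htens y h) = htens (tens x y) h }.

Variable K : hilbert_tensors.

(* X(n) (x)_sigma H, as a subspace of E^{(x) n} (x)_sigma H *)
Definition sub_htensor n : set (K n) :=
  closed_span [set htens K x h | x in @X n & h in setT].

(* Tt is the family of the contractions T~_n : X(n) (x)_sigma H -> H; the values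
   of Tt n outside X(n) (x)_sigma H are irrelevant. *)
Definition tilde_maps (T : forall n, E n -> H -> H) (Tt : forall n, K n -> H) :=
  forall n,
  [/\ forall (c : R[i]) (v w : K n), sub_htensor v -> sub_htensor w ->
        Tt n (c *: v + w) = c *: Tt n v + Tt n w,
      forall v : K n, sub_htensor v -> `|Tt n v| <= `|v|
    & forall (x : E n) h, X x -> Tt n (htens K x h) = T n x h].

Definition tilde_adjoints (Tt : forall n, K n -> H)
    (Ts : forall n, H -> K n) :=
  forall n h, sub_htensor (Ts n h) /\
    forall v : K n, sub_htensor v -> dot (Ts n h) v = dot h (Tt n v).

Definition coisometric (Tt : forall n, K n -> H) (Ts : forall n, H -> K n) :=
  forall n h, Tt n (Ts n h) = h.

(* pI n is the operator p n (x) I_H. *)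
Definition amplifications (pI : forall n, K n -> K n) :=
  forall n, bounded_operator (pI n) /\
    forall (x : E n) h, pI n (htens K x h) = htens K (p x) h.

End Representations.

(* Main.v *)
(* Write W_k for the adjoint of T~_k, an isometry of H into X(k) (x) H.  The
   limit hypothesis says exactly that S_n(z) W_k h - W_(n+k) T_n(z) h tends to 0
   as k grows, while S_n(z)^* W_(n+k) = W_k T_n(z)^* always holds.  Hence, with
   V_N := N^(-1/2) \sum_(N <= k < 2N) W_k, an isometry of H into F_X (x) H, the
   vectors f V_N h - V_N pi(f) h tend to 0 for f = S_n(z) and for f = S_n(z)^*.
   The f admitting such an operator pi(f), along with their adjoints, form a
   C^*-algebra, on which pi is a *-homomorphism; it contains T(X).

   F_X (x) H is replaced by finite formal sums of elementary tensors with their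
   semi-inner product, so that no completion is needed.  Adjointable f are
   bounded there because of the estimate <f u, f u> <= |f^* f| <u, u>, which
   follows from the Cauchy-Schwarz inequality alone. *)

Require Import Defs.
From HB Require Import structures.
From mathcomp Require Import all_boot all_order all_algebra.
From mathcomp Require Import all_classical all_reals all_analysis.
From mathcomp Require Import complex.
From mathcomp Require Import ring lra.
Import Order.TTheory GRing.Theory Num.Theory.
Import numFieldNormedType.Exports.
Local Open Scope classical_set_scope.
Local Open Scope ring_scope.

Set Implicit Arguments.
Unset Strict Implicit.
Unset Printing Implicit Defensive.

(** The averages are forced by the grading: [S_n(z)] raises degrees by n, so S_n(z) W_k h can only
    be close to W_(n+k) T_n(z) h, which for n > 0 is orthogonal to W_k T_n(z) h. Summing over a
    window of length N turns this change of index into 2 n boundary terms, negligible after division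
    by N.

    The limit hypothesis is strong enough because of the identity |S_n(z) W_k h - W_(n+k) T_n(z)
    h|^2 = |S_n(z) W_k h|^2 - |T_n(z) h|^2: coisometry makes W_(n+k) T_n(z) h the orthogonal
    projection of S_n(z) W_k h onto the range of W_(n+k). The relation for S_n(z)^* is the adjoint
    of T~_(n+k) (S_n(z) (x) I) = T_n(z) T~_k.

    W_k h is in general only a limit of finite sums of elementary tensors. It is replaced by such a
    sum at distance at most 1 / (k + 1), so that the V_N of the code are linear and isometric only
    in the limit. *)

(** * Real-valued norms, closed spans, bounded linear maps *)

Section RealNorm.
Variable R : realType.
Implicit Type V : normedZmodType R[i].

(** Norms live in [R[i]], whose order is partial; taking the real part gives access to the totally
    ordered field [R] and its arithmetic. *)
Definition nm V (v : V) : R := complex.Re `|v|.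

Lemma nmE V (v : V) : `|v| = (nm v)%:C%C.
Proof. by rewrite /nm RRe_real // normr_real. Qed.

Lemma nm_ge0 V (v : V) : 0 <= nm v.
Proof. by have := normr_ge0 v; rewrite nmE ler0c. Qed.

Lemma nm_lt V (v : V) (e : R) : (`|v| < e%:C%C) = (nm v < e).
Proof. by rewrite nmE ltcR. Qed.

Lemma nm0 V : nm (0 : V) = 0.
Proof. by rewrite /nm normr0. Qed.

Lemma nm_eq0 V (v : V) : nm v = 0 -> v = 0.
Proof. by move=> h; apply: normr0_eq0; rewrite nmE h. Qed.

Lemma nmN V (v : V) : nm (- v) = nm v.
Proof. by rewrite /nm normrN. Qed.

Lemma nmBC V (v w : V) : nm (v - w) = nm (w - v).
Proof. by rewrite /nm distrC. Qed.

Lemma nmD V (v w : V) : nm (v + w) <= nm v + nm w.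
Proof. by have := ler_normD v w; rewrite !nmE -rmorphD lecR. Qed.

Lemma nmB V (v w : V) : nm (v - w) <= nm v + nm w.
Proof. by rewrite -(nmN w) nmD. Qed.

Lemma nm_sum V (I : Type) (r : seq I) (f : I -> V) :
  nm (\sum_(i <- r) f i) <= \sum_(i <- r) nm (f i).
Proof.
elim: r => [|i r ih]; first by rewrite !big_nil nm0.
rewrite !big_cons; apply: le_trans (nmD _ _) _; exact: lerD.
Qed.

Lemma nmR (x : R) : nm (x%:C%C : R[i]) = `|x|.
Proof. by rewrite /nm normc_def /= expr0n /= addr0 sqrtr_sqr. Qed.

Lemma Re_le_nm (c : R[i]) : `|complex.Re c| <= nm c.
Proof. by have := normc_ge_Re c; rewrite nmE lecR. Qed.

Lemma nm_conj (c : R[i]) : nm c^* = nm c.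
Proof. by rewrite /nm norm_conjC. Qed.

Lemma ReE (c : R[i]) : 0 <= c -> c = (complex.Re c)%:C%C.
Proof. by move=> h; rewrite RRe_real // ger0_real. Qed.

Lemma Re_conj (c : R[i]) : complex.Re c^* = complex.Re c.
Proof. by case: c. Qed.

Lemma ReD (c d : R[i]) : complex.Re (c + d) = complex.Re c + complex.Re d.
Proof. by case: c; case: d. Qed.

Lemma ReN (c : R[i]) : complex.Re (- c) = - complex.Re c.
Proof. by case: c. Qed.

Lemma ReZ (r : R) (c : R[i]) : complex.Re (r%:C%C * c) = r * complex.Re c.
Proof. by case: c => a b /=; rewrite mul0r subr0. Qed.

Lemma gt0_real (e : R[i]) : 0 < e -> exists2 e' : R, 0 < e' & e = e'%:C%C.
Proof.
move=> e0; have he := ReE (ltW e0).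
by exists (complex.Re e) => //; rewrite -ltcR -he.
Qed.

Section Normed.
Variable V : normedModType R[i].

Lemma nmZ (c : R[i]) (v : V) : nm (c *: v) = nm c * nm v.
Proof. by rewrite /nm normrZ !nmE -rmorphM. Qed.

Lemma cvg_nmP (u : nat -> V) (l : V) :
  u @ \oo --> l <->
  forall e : R, 0 < e -> exists N, forall n, (N <= n)%N -> nm (l - u n) < e.
Proof.
split=> [/cvgrPdist_lt h e e0|h].
  have /h [N _ hN] : 0 < e%:C%C by rewrite ltcR.
  by exists N => n /hN /=; rewrite nm_lt.
apply/cvgrPdist_lt => e /gt0_real [e' e'0 ->].
have [N hN] := h _ e'0; exists N => // n /= /hN; by rewrite nm_lt.
Qed.

Lemma closed_nm (W : set V) :
  (forall v, (forall e : R, 0 < e -> exists2 w, W w & nm (v - w) < e) -> W v) ->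
  closed W.
Proof.
move=> h v cv; apply: h => e e0.
have [] := cv (ball v e%:C%C); first by apply: nbhsx_ballx; rewrite ltcR.
by move=> w [Ww]; rewrite -ball_normE /= nm_lt => ?; exists w.
Qed.

(** The first three premises make [P] a closed subspace, hence one of the sets intersected in
    [closed_span]. *)
Lemma closed_span_ind (S : set V) (P : V -> Prop) :
  P 0 -> (forall c x y, P x -> P y -> P (c *: x + y)) ->
  (forall v, (forall e : R, 0 < e -> exists2 w, P w & nm (v - w) < e) -> P v) ->
  (forall x, S x -> P x) ->
  forall v, closed_span S v -> P v.
Proof.
move=> P0 Pl Pc PS v; apply; split=> //=.
by split; [split|exact: closed_nm].
Qed.

Lemma closed_span_sub (S : set V) v : S v -> closed_span S v.
Proof. by move=> Sv W [_]; apply. Qed.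

Lemma closed_span0 (S : set V) : closed_span S 0.
Proof. by move=> W [[sW _] _]; exact: (proj1 sW). Qed.

Lemma closed_spanP (S : set V) c v w :
  closed_span S v -> closed_span S w -> closed_span S (c *: v + w).
Proof.
move=> hv hw W hW; have [[sW _] _] := hW.
by apply: (proj2 sW); [exact: hv|exact: hw].
Qed.

Lemma closed_span_approx (S : set V) v :
  (forall e : R, 0 < e -> exists2 w, closed_span S w & nm (v - w) < e) ->
  closed_span S v.
Proof.
move=> h W [[sW cW] SW]; apply: (cW) => B /nbhs_ballP [_ /= /gt0_real [e e0 ->] he].
have [w hw d] := h _ e0; exists w; split; first exact: (hw W (conj (conj sW cW) SW)).
by apply: he; rewrite -ball_normE /= nm_lt.
Qed.

End Normed.

Lemma nm_cauchy_cvg (V : completeNormedModType R[i]) (u : nat -> V) :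
  (forall e : R, 0 < e -> exists N, forall m n, (N <= m)%N -> (N <= n)%N ->
     nm (u m - u n) < e) ->
  exists l : V, u @ \oo --> l.
Proof.
move=> h; apply/cvg_ex; apply: cauchy_cvg; apply/cauchy_ballP => e.
move=> /gt0_real [e' e'0 ->].
have [N hN] := h _ e'0; near_simpl.
exists ([set n | (N <= n)%N], [set n | (N <= n)%N]).
  by split; exists N.
by case=> m n [/= hm hn]; rewrite -ball_normE /= nm_lt; exact: hN.
Qed.

Lemma bounded_of_continuous (V W : normedModType R[i]) (f : V -> W) :
  linear f -> continuous f ->
  exists2 C : R, 0 < C & forall v, nm (f v) <= C * nm v.
Proof.
move=> lf cf.
have f0 : f 0 = 0 by have := lf (-1) 0 0; rewrite scaler0 addr0 scaleN1r addNr.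
have fZ c v : f (c *: v) = c *: f v.
  by have := lf c v 0; rewrite addr0 f0 addr0.
have /cvgrPdist_lt/(_ 1 ltr01) : f v @[v --> (0 : V)] --> f 0 by exact: cf.
rewrite f0 => /nbhs_ballP [e0 /= /gt0_real [e e_gt0 ->] he].
have he' v : nm v < e -> nm (f v) < 1.
  move=> hv; have : `|0 - f v| < 1.
    by apply: he; rewrite -ball_normE /= sub0r normrN nm_lt.
  by rewrite sub0r normrN -[1]/(1%:C%C) nm_lt.
(* The ball of radius [e] is sent into the unit ball; scaling [v] to norm [e / 2] costs the factor
   [2 / e]. *)
exists (2 / e); first by rewrite divr_gt0.
move=> v; have [v0|v0] := eqVneq (nm v) 0.
  by rewrite (nm_eq0 v0) f0 !nm0 mulr0.
have v_gt0 : 0 < nm v by rewrite lt_neqAle eq_sym v0 nm_ge0.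
have := he' ((e / 2 / nm v)%:C%C *: v).
have d_gt0 : 0 < e / 2 / nm v by rewrite !divr_gt0.
rewrite fZ !nmZ nmR gtr0_norm // divfK // => /(_ _)/ltW h.
rewrite -(ler_pM2l d_gt0); apply: le_trans (h _) _; first by lra.
by rewrite le_eqVlt; apply/orP; left; apply/eqP; field; rewrite v0 gt_eqF.
Qed.

Lemma continuous_of_bounded (V W : normedModType R[i]) (f : V -> W) (C : R) :
  linear f -> 0 < C -> (forall v, nm (f v) <= C * nm v) -> continuous f.
Proof.
move=> lf C0 hC v; apply/cvgrPdist_lt => e /gt0_real [e' e'0 ->].
have fB x y : f (x - y) = f x - f y.
  by rewrite addrC -scaleN1r lf scaleN1r addrC.
near=> w; rewrite -fB nm_lt; apply: le_lt_trans (hC _) _.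
rewrite mulrC -ltr_pdivlMr // -nm_lt.
near: w; apply: (@cvgr_dist_lt _ _ _ (nbhs v) _ id v); first exact: cvg_id.
by rewrite ltcR divr_gt0.
Unshelve. all: by end_near. Qed.

End RealNorm.

(** * Consequences of the predicate [linear] *)

Section LinearMaps.
Variables (K : numFieldType) (U V : lmodType K) (f : U -> V).
Hypothesis lf : linear f.

Lemma lin0 : f 0 = 0.
Proof. by have := lf (-1) 0 0; rewrite scaler0 addr0 scaleN1r addNr. Qed.

Lemma linZ c v : f (c *: v) = c *: f v.
Proof. by have := lf c v 0; rewrite addr0 lin0 addr0. Qed.

Lemma linD v w : f (v + w) = f v + f w.
Proof. by rewrite -[v in LHS]scale1r lf scale1r. Qed.

Lemma linB v w : f (v - w) = f v - f w.
Proof. by rewrite addrC -scaleN1r lf scaleN1r addrC. Qed.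

Lemma lin_sum (I : Type) (r : seq I) (F : I -> U) :
  f (\sum_(i <- r) F i) = \sum_(i <- r) f (F i).
Proof.
elim: r => [|i r ih]; first by rewrite !big_nil lin0.
by rewrite !big_cons linD ih.
Qed.

End LinearMaps.

(** * Real inequalities and geometric convergence *)

Section RealFacts.
Variable R : realType.

(** The quadratic is tested at its minimum [s = 1 / w]; for [w = 0] it is affine with slope [- 2 b],
    which forces [b = 0]. *)
Lemma discriminant_le (q b w : R) : 0 <= b -> 0 <= w ->
  (forall s, 0 <= q - 2 * s * b + s ^+ 2 * b * w) -> b <= q * w.
Proof.
move=> b0 w0 h; have q0 : 0 <= q.
  by have := h 0; rewrite !(mul0r, mulr0, expr0n) subr0 addr0.
have [w_eq0|w_neq0] := eqVneq w 0.
  have [->|b_neq0] := eqVneq b 0; first by rewrite mulr_ge0.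
  have := h ((q + 1) / b); rewrite w_eq0 !mulr0 addr0 -mulrA divfK //.
  by move=> ?; exfalso; lra.
have w_gt0 : 0 < w by rewrite lt_neqAle eq_sym w_neq0.
rewrite -ler_pdivrMr //; have := h w^-1.
have -> : q - 2 * w^-1 * b + w^-1 ^+ 2 * b * w = q - b / w by field.
by rewrite subr_ge0.
Qed.

(** Iterating the first bound and taking roots of order 2^j makes the constant [t] disappear. To
    avoid roots, suppose [a 0 = q c r] with [r > 1]: then [a j] is at least [q (c r)^(2^j)], so
    [q r^(2^j) <= t] for all [j], against Bernoulli's inequality. *)
Lemma power_trick (q c t : R) (a : nat -> R) : 0 <= q -> 0 <= c ->
  (forall j, a j ^+ 2 <= q * a j.+1) -> (forall j, a j <= t * c ^+ (2 ^ j)) ->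
  a 0%N <= q * c.
Proof.
move=> q0 c0 h1 h2; rewrite leNgt; apply/negP => a0.
have a0_gt0 : 0 < a 0%N by apply: le_lt_trans a0; rewrite mulr_ge0.
have [q_eq0|q_neq0] := eqVneq q 0.
  have := h1 0%N; rewrite q_eq0 mul0r leNgt; apply/negP.
  by rewrite negbK exprn_gt0.
have [c_eq0|c_neq0] := eqVneq c 0.
  have := h2 1%N; rewrite c_eq0 expr0n /= mulr0 => a1.
  have := h1 0%N; rewrite leNgt; apply/negP; rewrite negbK.
  apply: le_lt_trans (exprn_gt0 2 a0_gt0).
  by rewrite mulr_ge0_le0.
have q_gt0 : 0 < q by rewrite lt_neqAle eq_sym q_neq0.
have c_gt0 : 0 < c by rewrite lt_neqAle eq_sym c_neq0.
pose r := a 0%N / (q * c).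
have r1 : 1 < r by rewrite /r ltr_pdivlMr ?mul1r // mulr_gt0.
have r0 : 0 < r by apply: lt_trans r1.
have aj j : q * (c * r) ^+ (2 ^ j) <= a j.
  elim: j => [|j ih].
    rewrite expn0 expr1 /r mulrA mulrC divfK //.
    by rewrite mulf_neq0.
  rewrite -(ler_pM2l q_gt0); apply: le_trans (h1 j).
  have -> : q * (q * (c * r) ^+ (2 ^ j.+1)) = (q * (c * r) ^+ (2 ^ j)) ^+ 2.
    by rewrite expnSr exprM; ring.
  have x0 : 0 <= q * (c * r) ^+ (2 ^ j).
    by rewrite mulr_ge0 // exprn_ge0 // mulr_ge0 // ltW.
  apply: lerXn2r => //; rewrite nnegrE //.
  exact: le_trans ih.
move: r r1 r0 aj => {}r r1 r0 aj.
have bern (n : nat) : 1 + n%:R * (r - 1) <= r ^+ n.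
  elim: n => [|n ih]; first by rewrite mul0r addr0 expr0.
  rewrite exprS; apply: le_trans (ler_wpM2l (ltW r0) ih).
  rewrite -natr1.
  have : 0 <= n%:R * (r - 1) ^+ 2 by rewrite mulr_ge0 // sqr_ge0.
  nra.
have bnd j : q * (1 + j%:R * (r - 1)) <= t.
  have cj : 0 < c ^+ (2 ^ j) by rewrite exprn_gt0.
  apply: (@le_trans _ _ (q * r ^+ (2 ^ j))); last first.
    rewrite -(ler_pM2l cj) [leRHS]mulrC; apply: le_trans (h2 j).
    by apply: le_trans (aj j); rewrite exprMn mulrCA.
  rewrite ler_wpM2l //; apply: le_trans (bern _).
  rewrite lerD2l; apply: ler_wpM2r; first by rewrite subr_ge0 ltW.
  by rewrite ler_nat ltnW // ltn_expl.
have r_gt1 : 0 < q * (r - 1) by rewrite mulr_gt0 // subr_gt0.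
have := bnd (Num.truncn (t / (q * (r - 1)))).+1; rewrite leNgt; apply/negP.
rewrite negbK.
have : t / (q * (r - 1)) < (Num.truncn (t / (q * (r - 1)))).+1%:R by exact: truncnS_gt.
rewrite ltr_pdivrMr // => h; apply: lt_trans h _.
set n := (Num.truncn _).+1%:R.
rewrite (_ : q * (1 + _) = n * (q * (r - 1)) + q); last by ring.
by rewrite ltrDl.
Qed.

Lemma geometric_cvg (V : completeNormedModType R[i]) (u : nat -> V) (C r : R) :
  0 <= r < 1 -> (forall n, nm (u n.+1 - u n) <= C * r ^+ n) ->
  exists2 l : V, u @ \oo --> l & forall n, nm (l - u n) <= C * r ^+ n / (1 - r).
Proof.
move=> /andP[r0 r1] h.
have r1' : 0 < 1 - r by rewrite subr_gt0.
have C0 : 0 <= C by have := h 0%N; rewrite expr0 mulr1; apply: le_trans; exact: nm_ge0.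
have rn n : 0 <= r ^+ n by rewrite exprn_ge0.
have hk n k : nm (u (n + k)%N - u n) <= C * r ^+ n * (1 - r ^+ k) / (1 - r).
  elim: k => [|k ih]; first by rewrite addn0 subrr nm0 expr0 subrr mulr0 mul0r.
  rewrite addnS -(subrKA (u (n + k)%N)).
  apply: le_trans (nmD _ _) _; apply: le_trans (lerD (h _) ih) _.
  rewrite le_eqVlt; apply/orP; left; apply/eqP; rewrite exprD exprS; field.
  by rewrite gt_eqF.
have hk' n m : (n <= m)%N -> nm (u m - u n) <= C * r ^+ n / (1 - r).
  move=> /subnKC <-; apply: le_trans (hk _ _) _.
  rewrite ler_wpM2r ?invr_ge0 ?(ltW r1') // ler_piMr ?mulr_ge0 //.
  by rewrite gerBl.
have lim0 (e : R) : 0 < e -> exists N, forall n, (N <= n)%N -> C * r ^+ n / (1 - r) < e.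
  move=> e0.
  have : (fun n => C / (1 - r) * r ^+ n) @ \oo --> C / (1 - r) * 0.
    by apply: cvgMr; apply: cvg_expr; rewrite ger0_norm.
  rewrite mulr0 => /cvgrPdist_lt/(_ _ e0) [N _ hN]; exists N => n /hN /=.
  rewrite sub0r normrN; apply: le_lt_trans; rewrite mulrAC; exact: ler_norm.
have [l ul] : exists l : V, u @ \oo --> l.
  apply: nm_cauchy_cvg => e e0; have [N hN] := lim0 _ e0; exists N => m n Nm Nn.
  case/orP: (leq_total m n) => mn; first rewrite nmBC.
    exact: le_lt_trans (hk' _ _ mn) (hN _ Nm).
  exact: le_lt_trans (hk' _ _ mn) (hN _ Nn).
exists l => // n; apply/ler_addgt0Pr => e e0.
have [N hN] := (cvg_nmP _ _).1 ul _ e0.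
rewrite -(subrKA (u (maxn N n))).
rewrite addrC; apply: le_trans (nmD _ _) _; apply: lerD.
  by apply: hk'; rewrite leq_maxr.
by apply/ltW/hN; rewrite leq_maxl.
Qed.

End RealFacts.

(** * Conjugation and the Cauchy-Schwarz inequality *)

Section Conjugation.
Variable R : realType.
Implicit Types c d : R[i].

Lemma cjD c d : (c + d)^* = c^* + d^*. Proof. exact: rmorphD. Qed.
Lemma cjM c d : (c * d)^* = c^* * d^*. Proof. exact: rmorphM. Qed.
Lemma cjN c : (- c)^* = - c^*. Proof. exact: rmorphN. Qed.

End Conjugation.

Section SemiInner.
Variables (R : realType) (A : Type) (add : A -> A -> A) (scale : R[i] -> A -> A).
Variable form : A -> A -> R[i].
Hypothesis formDr : forall u v w, form u (add v w) = form u v + form u w.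
Hypothesis formZr : forall u c v, form u (scale c v) = c * form u v.
Hypothesis formC : forall u v, form u v = (form v u)^*.
Hypothesis form_ge0 : forall u, 0 <= form u u.

(** [A] carries no vector space laws, so that the lists representing formal tensors are covered as
    well as Hilbert spaces. *)
Lemma semi_cauchy_schwarz u v :
  nm (form u v) ^+ 2 <= complex.Re (form u u) * complex.Re (form v v).
Proof.
have Re0 w : 0 <= complex.Re (form w w) by rewrite -ler0c -ReE.
apply: discriminant_le => //; first by rewrite sqr_ge0.
move=> s; set b := form u v.
(* The factor [b^*] aligns the phases: the cross terms become the real number [- 2 s |b|^2]. *)
have := Re0 (add u (scale (- (s%:C%C * b^*)) v)).
rewrite formDr formZr (formC (add _ _) u) (formC (add _ _) v) !formDr !formZr.
rewrite (formC v u) -/b.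
rewrite !(cjD, cjM, cjN, conjCK).
have sR : (s%:C%C : R[i])^* = s%:C%C by exact: conjc_real.
have bb : b * b^* = (nm b ^+ 2)%:C%C by rewrite -normCK nmE -rmorphXn.
rewrite sR -(formC u u) -(formC v v) (_ : _ + _ = form u u - 2 * (s%:C%C * (b * b^*)) +
   s%:C%C ^+ 2 * (b * b^*) * form v v); last by ring.
rewrite bb (ReE (form_ge0 u)) (ReE (form_ge0 v)).
set x := complex.Re (form u u); set y := complex.Re (form v v).
rewrite (_ : _ + _ = (x - 2 * s * nm b ^+ 2 + s ^+ 2 * nm b ^+ 2 * y)%:C%C) //.
by rewrite !expr2 rmorphD rmorphB !rmorphM rmorph_nat; ring.
Qed.

End SemiInner.

(** * Hilbert spaces *)

Section Hilbert.
Variables (R : realType) (H : hilbert R).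
Implicit Types h g : H.

Lemma dotDr h g g' : dot h (g + g') = dot h g + dot h g'.
Proof. by have := dot_linear h 1 g g'; rewrite scale1r mul1r. Qed.

Lemma dot0r h : dot h 0 = 0.
Proof. by apply: (addIr (dot h 0)); rewrite -dotDr !add0r. Qed.

Lemma dotZr h c g : dot h (c *: g) = c * dot h g.
Proof. by have := dot_linear h c g 0; rewrite dot0r !addr0. Qed.

Lemma dotBr h g g' : dot h (g - g') = dot h g - dot h g'.
Proof. by rewrite -scaleN1r dotDr dotZr mulN1r. Qed.

Lemma dotDl h h' g : dot (h + h') g = dot h g + dot h' g.
Proof. by rewrite dot_conj dotDr cjD -!dot_conj. Qed.

Lemma dotZl c h g : dot (c *: h) g = c^* * dot h g.
Proof. by rewrite dot_conj dotZr cjM -dot_conj. Qed.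

Lemma dotBl h h' g : dot (h - h') g = dot h g - dot h' g.
Proof. by rewrite -scaleN1r dotDl dotZl cjN conjC1 mulN1r. Qed.

Lemma dot_suml (I : Type) (r : seq I) (F : I -> H) g :
  dot (\sum_(i <- r) F i) g = \sum_(i <- r) dot (F i) g.
Proof.
elim: r => [|i r ih]; first by rewrite !big_nil dot_conj dot0r conjC0.
by rewrite !big_cons dotDl ih.
Qed.

Lemma dot_sumr (I : Type) (r : seq I) (F : I -> H) g :
  dot g (\sum_(i <- r) F i) = \sum_(i <- r) dot g (F i).
Proof.
elim: r => [|i r ih]; first by rewrite !big_nil dot0r.
by rewrite !big_cons dotDr ih.
Qed.

Lemma dotE h : dot h h = (nm h ^+ 2)%:C%C.
Proof. by rewrite -dot_norm nmE -rmorphXn. Qed.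

Lemma Re_dot h : complex.Re (dot h h) = nm h ^+ 2.
Proof. by rewrite dotE. Qed.

Lemma cauchy_schwarz h g : nm (dot h g) <= nm h * nm g.
Proof.
rewrite -(@ler_pXn2r _ 2) // ?nnegrE ?mulr_ge0 ?nm_ge0 // exprMn -!Re_dot.
apply: (semi_cauchy_schwarz (add := +%R) (scale := *:%R)).
- exact: dotDr.
- exact: dotZr.
- exact: dot_conj.
- by move=> u; rewrite dotE ler0c sqr_ge0.
Qed.

Lemma nm_sqrB h g :
  nm (h - g) ^+ 2 = nm h ^+ 2 - 2 * complex.Re (dot h g) + nm g ^+ 2.
Proof.
rewrite -!Re_dot dotBl !dotBr !(ReD, ReN) (dot_conj g h) Re_conj; ring.
Qed.

End Hilbert.

Lemma nm_small0 (R : realType) (V : normedZmodType R[i]) (v : V) (C : R) :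
  0 < C -> (forall e, 0 < e -> nm v <= C * e) -> v = 0.
Proof.
move=> C0 h; apply: nm_eq0; apply/eqP; rewrite eq_le nm_ge0 andbT.
apply/ler_addgt0Pr => e e0; rewrite add0r.
by apply: le_trans (h (e / C) _) _; rewrite ?divr_gt0 // mulrC divfK // gt_eqF.
Qed.

(** * Square roots in a C*-algebra and contractivity of representations *)

Section CstarAlgebra.
Variables (R : realType) (M : cstar_algebra R).
Implicit Types a b c d : M.

Lemma amul_linr a : linear (amul a).
Proof. by move=> k b c; exact: amul_linearr. Qed.

Lemma amul_linl b : linear (fun a => amul a b).
Proof. by move=> k a c; exact: amul_linearl. Qed.

Lemma nm_amul a b : nm (amul a b) <= nm a * nm b.
Proof. by have := amul_norm a b; rewrite !nmE -rmorphM lecR. Qed.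

Lemma nm_star_mul a : nm (amul (astar a) a) = nm a ^+ 2.
Proof. by have := cstar_identity a; rewrite !nmE -rmorphXn => -[]. Qed.

Lemma nm_astar a : nm (astar a) = nm a.
Proof.
have le b : nm b <= nm (astar b).
  have [b0|b0] := eqVneq (nm b) 0; first by rewrite b0 nm_ge0.
  have b_gt0 : 0 < nm b by rewrite lt_neqAle eq_sym b0 nm_ge0.
  by rewrite -(ler_pM2r b_gt0) -expr2 -nm_star_mul nm_amul.
by apply/eqP; rewrite eq_le le andbT -{2}(astarK a) le.
Qed.

Lemma astarB a b : astar (a - b) = astar a - astar b.
Proof.
by rewrite addrC -scaleN1r astar_antilinear cjN conjC1 scaleN1r addrC.
Qed.

Lemma astarD a b : astar (a + b) = astar a + astar b.
Proof. by rewrite -[a in LHS]scale1r astar_antilinear conjC1 scale1r. Qed.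

Lemma astar0 : astar (0 : M) = 0.
Proof. by have := astarB 0 0; rewrite !subrr. Qed.

Lemma astarZ k a : astar (k *: a) = k^* *: astar a.
Proof. by rewrite -[_ *: a]addr0 astar_antilinear astar0 addr0. Qed.

Lemma nm_sqr_diff a b :
  nm (amul a a - amul b b) <= (nm a + nm b) * nm (a - b).
Proof.
have -> : amul a a - amul b b = amul a (a - b) + amul (a - b) b.
  by rewrite (linB (amul_linr a)) (linB (amul_linl b)) addrA subrK.
apply: le_trans (nmD _ _) _; rewrite mulrDl; apply: lerD; first exact: nm_amul.
by rewrite [leRHS]mulrC nm_amul.
Qed.

(* [d] is the fixed point of the contraction [d |-> (c + d^2) / 2], so that
   [1 - c = (1 - d)^2]. *)
Lemma selfadjoint_sqrt c : astar c = c -> nm c < 1 ->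
  exists2 d, astar d = d & d + d - amul d d = c.
Proof.
move=> cc c1; set r := nm c; have r0 : 0 <= r by exact: nm_ge0.
pose half : R[i] := 2^-1%:C%C.
have nm_half : nm half = 2^-1 by rewrite nmR ger0_norm.
have half_conj : half^* = half := conjc_real _.
have half2 x : half *: x + half *: x = x :> M.
  rewrite -scalerDl -[X in _ = X]scale1r; congr (_ *: _).
  by rewrite /half -rmorphD; congr (_%:C%C); field.
pose f x := half *: (c + amul x x) : M.
pose u n := iter n f 0.
(* The ball of radius [r] is stable since [(r + r^2) / 2 <= r], and on it [f] is [r]-Lipschitz since
   [(nm x + nm y) / 2 <= r]. *)
have ur n : nm (u n) <= r.
  elim: n => [|n ih]; first by rewrite nm0.
  rewrite /u iterS -/(u n) /f nmZ nm_half.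
  have : nm (c + amul (u n) (u n)) <= r + nm (u n) * nm (u n).
    by apply: le_trans (nmD _ _) _; rewrite lerD2l nm_amul.
  have := nm_ge0 (u n); rewrite -/r in c1; nra.
have fB x y : nm (f x - f y) <= 2^-1 * ((nm x + nm y) * nm (x - y)).
  rewrite /f -scalerBr nmZ nm_half ler_pM2l // opprD addrACA subrr add0r.
  exact: nm_sqr_diff.
have du n : nm (u n.+1 - u n) <= r * r ^+ n.
  elim: n => [|n ih]; first by rewrite expr0 mulr1 subr0 ur.
  rewrite /u iterS [iter n.+1 f 0 in X in _ - X]iterS -/(u n) -/(u n.+1).
  apply: le_trans (fB _ _) _; rewrite exprS.
  have := ler_pM (addr_ge0 (nm_ge0 (u n.+1)) (nm_ge0 (u n))) (nm_ge0 _)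
    (lerD (ur n.+1) (ur n)) ih.
  nra.
have r01 : 0 <= r < 1 by rewrite r0.
have [l ul _] := geometric_cvg r01 du.
have close (e : R) : 0 < e -> exists n, nm (l - u n) < e /\ nm (l - u n.+1) < e.
  move=> e0; have [N hN] := (cvg_nmP _ _).1 ul _ e0.
  by exists N; split; apply: hN => /=.
have fl : f l = l.
  apply/eqP; rewrite -subr_eq0; apply/eqP.
  apply: (@nm_small0 _ _ _ (2^-1 * (nm l + r) + 1)).
    by rewrite ltr_wpDl // mulr_ge0 // addr_ge0 // nm_ge0.
  move=> e e0; have [n [h1 h2]] := close e e0.
  rewrite -(subrKA (u n.+1)) addrC; apply: le_trans (nmD _ _) _.
  rewrite addrC mulrDl mul1r; apply: lerD; last by rewrite nmBC ltW.
  rewrite /u iterS -/(u n); apply: le_trans (fB _ _) _.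
  rewrite -mulrA ler_pM2l //; apply: ler_pM; rewrite ?nm_ge0 ?addr_ge0 ?nm_ge0 //.
    by rewrite lerD2l.
  exact: ltW.
have uu n : astar (u n) = u n.
  elim: n => [|n ih]; first exact: astar0.
  by rewrite /u iterS -/(u n) /f astarZ half_conj astarD astarM ih cc.
exists l.
  apply/eqP; rewrite -subr_eq0; apply/eqP; apply: (@nm_small0 _ _ _ 2) => // e e0.
  have [n [h1 _]] := close e e0.
  rewrite -(subrKA (u n)) -{1}(uu n) -astarB.
  apply: le_trans (nmD _ _) _; rewrite nm_astar [X in _ + X]nmBC.
  by move: h1; lra.
apply/eqP; rewrite subr_eq; apply/eqP.
by rewrite -{1 2}fl /f half2.
Qed.

Variable H : hilbert R.
Variable sigma : M -> H -> H.
Hypothesis hs : representation sigma.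

Lemma rep_lin a : linear (sigma a).
Proof. by have [] := rep_bounded hs (I : setT a). Qed.

Lemma repP k a b h : sigma (k *: a + b) h = k *: sigma a h + sigma b h.
Proof. exact: (rep_linear hs). Qed.

Lemma repD a b h : sigma (a + b) h = sigma a h + sigma b h.
Proof. by have := repP 1 a b h; rewrite !scale1r. Qed.

Lemma repM a b h : sigma (amul a b) h = sigma a (sigma b h).
Proof. exact: (rep_mul hs). Qed.

Lemma rep_adj a h g : dot (sigma (astar a) h) g = dot h (sigma a g).
Proof. exact: (rep_star hs). Qed.

Lemma rep_linl h : linear (fun a => sigma a h).
Proof. by move=> k a b; exact: repP. Qed.

(** With [c = 2 d - d^2] the difference of the two sides is [|h - sigma(d) h|^2]; the unit that [M]
    may lack is replaced by the identity of [H]. *)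
Lemma rep_le_norm c h : astar c = c -> nm c < 1 ->
  complex.Re (dot h (sigma c h)) <= nm h ^+ 2.
Proof.
move=> cc c1; have [d dd <-] := selfadjoint_sqrt cc c1.
rewrite -subr_ge0; have := sqr_ge0 (nm (h - sigma d h)).
rewrite nm_sqrB -(Re_dot (sigma d h)) -{2}dd rep_adj -repM.
rewrite (linB (rep_linl h)) repD dotBr dotDr ReD ReN ReD.
set x := complex.Re _; set y := complex.Re _; lra.
Qed.

Lemma rep_contractive a h : nm (sigma a h) <= nm a * nm h.
Proof.
have small b g : nm b < 1 -> nm (sigma b g) <= nm g.
  move=> b1; rewrite -(@ler_pXn2r _ 2) // ?nnegrE ?nm_ge0 //.
  rewrite -Re_dot -{1}(astarK b) rep_adj -repM; apply: rep_le_norm.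
    by rewrite astarM astarK.
  by rewrite nm_star_mul expr_lt1 // nm_ge0.
apply/ler_addgt0Pr => e e0.
(* [small] needs norm strictly below 1, so [a] is divided by slightly more than [nm a]; the excess
   costs at most [e]. *)
pose t := nm a + e / (nm h + 1).
have h1 : 0 < nm h + 1 by rewrite ltr_wpDl // nm_ge0.
have d0 : 0 < e / (nm h + 1) by rewrite divr_gt0.
have t0 : 0 < t by rewrite /t ltr_wpDl // nm_ge0.
have := small ((t^-1)%:C%C *: a) h.
rewrite nmZ (linZ (rep_linl h)) nmZ nmR ger0_norm ?invr_ge0 ?(ltW t0) //.
rewrite ltr_pdivrMl // mulr1 ler_pdivrMl //.
rewrite /t ltrDl => /(_ d0) h2; apply: le_trans h2 _.
rewrite mulrDl lerD2l mulrAC -mulrA ler_piMr ?(ltW e0) //.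
by rewrite ler_pdivrMr // mul1r lerDl.
Qed.

End CstarAlgebra.

(** * Inner products of Hilbert modules *)

Section HilbertModule.
Variables (R : realType) (M : cstar_algebra R) (F : hilbert_module M).
Implicit Types x y z : F.

Lemma ip_linr x : linear (ip x).
Proof. by move=> k y z; exact: ip_linear. Qed.

Lemma ipDr x y z : ip x (y + z) = ip x y + ip x z.
Proof. exact: (linD (ip_linr x)). Qed.

Lemma ipZr k x y : ip x (k *: y) = k *: ip x y.
Proof. exact: (linZ (ip_linr x)). Qed.

Lemma ipBr x y z : ip x (y - z) = ip x y - ip x z.
Proof. exact: (linB (ip_linr x)). Qed.

Lemma ipDl x y z : ip (x + y) z = ip x z + ip y z.
Proof. by rewrite -ip_star ipDr astarD !ip_star. Qed.

Lemma ipZl k x y : ip (k *: x) y = k^* *: ip x y.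
Proof. by rewrite -ip_star ipZr astarZ ip_star. Qed.

Lemma ipBl x y z : ip (x - y) z = ip x z - ip y z.
Proof. by rewrite -ip_star ipBr astarB !ip_star. Qed.

Lemma ip0l x : ip 0 x = 0.
Proof. by have := ipBl 0 0 x; rewrite !subrr. Qed.

Lemma nm_ip x : nm (ip x x) = nm x ^+ 2.
Proof. by have := ip_norm x; rewrite !nmE -rmorphXn => -[]. Qed.

Lemma ip_eq x y : (forall z, ip z x = ip z y) -> x = y.
Proof.
move=> h; apply/eqP; rewrite -subr_eq0; apply/eqP/nm_eq0/eqP.
by rewrite -sqrf_eq0 -nm_ip ipBr h subrr nm0.
Qed.

Lemma ip_parallelogram x y :
  ip (x + y) (x + y) - ip (x - y) (x - y) = ip x y + ip y x + (ip x y + ip y x).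
Proof.
rewrite ipBl ipDl !ipBr !ipDr !opprB.
rewrite [LHS](AC (2*2*(2*2)) (1*8*(4*6)*(2*3*(7*5)))) /= !subrr.
by rewrite add0r add0r.
Qed.

(** Polarization: for [v] and [w] in the unit ball, 4 <v, w> combines the squares of the four
    vectors v + w, v - w, v + iw, v - iw of norm at most 2, hence has norm at most 16. Later
    estimates absorb the factor 4. *)
Lemma nm_ip_le x y : nm (ip x y) <= 4 * (nm x * nm y).
Proof.
have unit_le (v w : F) : nm v <= 1 -> nm w <= 1 -> nm (ip v w) <= 4.
  move=> v1 w1.
  have four : 4 *: ip v w = ip (v + w) (v + w) - ip (v - w) (v - w)
      - 'i *: (ip (v + 'i *: w) (v + 'i *: w) - ip (v - 'i *: w) (v - 'i *: w)).
    rewrite !ip_parallelogram ipZl ipZr conjCi scaleNr -scalerBr -scalerDr.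
    rewrite scalerA -expr2 sqrCi scaleN1r opprK scaler_nat !mulrS mulr0n.
    rewrite [RHS](AC (2*2*(2*2)) (1*3*(5*7)*((2*6)*(4*8)))) /= !subrr !addr0.
    by rewrite !addrA.
  have le4 (z : F) : nm z <= 2 -> nm (ip z z) <= 4.
    by move=> z2; rewrite nm_ip; have := nm_ge0 z; nra.
  have i1 : nm ('i : R[i]) = 1 by rewrite /nm normCi.
  have vw : nm (v + w) <= 2 by apply: le_trans (nmD _ _) _; lra.
  have vw' : nm (v - w) <= 2 by apply: le_trans (nmB _ _) _; lra.
  have vi : nm (v + 'i *: w) <= 2.
    by apply: le_trans (nmD _ _) _; rewrite nmZ i1; lra.
  have vi' : nm (v - 'i *: w) <= 2.
    by apply: le_trans (nmB _ _) _; rewrite nmZ i1; lra.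
  have : nm (4 *: ip v w) <= 16.
    rewrite four; apply: le_trans (nmB _ _) _; rewrite nmZ i1 mul1r.
    have := le_trans (nmB _ _) (lerD (le4 _ vw) (le4 _ vw')).
    have := le_trans (nmB _ _) (lerD (le4 _ vi) (le4 _ vi')).
    lra.
  rewrite nmZ; have -> : nm (4 : R[i]) = 4.
    by rewrite -(rmorph_nat (real_complex R)) nmR normr_nat.
  lra.
have [x0|x0] := eqVneq (nm x) 0.
  by rewrite (nm_eq0 x0) ip0l !nm0 mul0r mulr0.
have [y0|y0] := eqVneq (nm y) 0.
  by rewrite (nm_eq0 y0) -ip_star ip0l astar0 !nm0 !mulr0.
have x_gt0 : 0 < nm x by rewrite lt_neqAle eq_sym x0 nm_ge0.
have y_gt0 : 0 < nm y by rewrite lt_neqAle eq_sym y0 nm_ge0.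
have := unit_le ((nm x)^-1%:C%C *: x) ((nm y)^-1%:C%C *: y).
rewrite ipZl ipZr !nmZ nm_conj !nmR !ger0_norm ?invr_ge0 ?nm_ge0 //.
rewrite !mulVf // => /(_ (lexx _) (lexx _)).
by rewrite mulrA -invfM mulrC ler_pdivrMr ?mulr_gt0 // [4 * _]mulrC.
Qed.

End HilbertModule.

(** * Adjointable maps *)

Section Adjointable.
Variables (R : realType) (M : cstar_algebra R) (F : hilbert_module M).
Implicit Types (f g : F -> F) (x y z : F).

Lemma adjoint_sym f g : adjoint_pair f g -> adjoint_pair g f.
Proof. by move=> fg x y; rewrite -ip_star -fg ip_star. Qed.

Lemma adjoint_unique f g g' : adjoint_pair f g -> adjoint_pair f g' -> g = g'.
Proof.
by move=> fg fg'; apply/funext => x; apply: ip_eq => z; rewrite -fg -fg'.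
Qed.

Lemma adjoint_linear f g : adjoint_pair f g -> linear f.
Proof.
move=> /adjoint_sym gf k x y; apply: ip_eq => z.
by rewrite ip_linear -!gf ip_linear.
Qed.

Lemma adjoint_comp f g f' g' :
  adjoint_pair f g -> adjoint_pair f' g' -> adjoint_pair (f \o f') (g' \o g).
Proof. by move=> fg fg' x y; rewrite /= fg fg'. Qed.

Lemma adjoint_combination (c : R[i]) f g f' g' :
  adjoint_pair f g -> adjoint_pair f' g' ->
  adjoint_pair (fun x => c *: f x + f' x) (fun x => c^* *: g x + g' x).
Proof. by move=> fg fg' x y; rewrite ipDl ipZl ipDr ipZr fg fg'. Qed.

Lemma adjoint_iter f n : adjoint_pair f f -> adjoint_pair (iter n f) (iter n f).
Proof.
move=> ff; elim: n => [|n ih] x y //=.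
by rewrite ff ih -iterSr.
Qed.

Lemma nm_ip_scaled x (c : R) : 0 <= c -> nm (ip x (c%:C%C *: x)) = c * nm x ^+ 2.
Proof. by move=> c0; rewrite ipZr nmZ nmR nm_ip ger0_norm. Qed.

(* Gliding hump: if [nm (v n) = 1] while [f (v n)] grows fast, then [x] is built
   so that [ip (f (v n)) x = ip (v n) (g x)] is unbounded. *)
Lemma adjointable_bounded f g : adjoint_pair f g ->
  exists2 C : R, 0 < C & forall x, nm (f x) <= C * nm x.
Proof.
move=> fg; have lf := adjoint_linear fg.
apply: contrapT => nb.
(* The steps [y n] have norm 9^-n, so those after step [n] add up to at most 9^-n / 8. With the
   factor 4 of [nm_ip_le] they spoil at most half of [9^-n * nm (w n)]. The other half exceeds
   [4 (n + 1)] and is at most [4 * nm (g x)], whence the factor 8. *)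
have [v hv] : {v : nat -> F & forall n, nm (v n) = 1 /\
    8 * n.+1%:R * 9 ^+ n < nm (f (v n))}.
  apply: (@choice _ _ (fun n v => nm v = 1 /\ 8 * n.+1%:R * 9 ^+ n < nm (f v))) => n.
  apply: contrapT => hn; apply: nb.
  have C0 : 0 < 8 * n.+1%:R * 9 ^+ n :> R by rewrite !mulr_gt0 // exprn_gt0.
  exists (8 * n.+1%:R * 9 ^+ n) => // x; rewrite leNgt; apply/negP => hx; apply: hn.
  have x0 : nm x != 0.
    apply/eqP => x0; move: hx.
    by rewrite (nm_eq0 x0) (lin0 lf) !nm0 mulr0 ltxx.
  have x_gt0 : 0 < nm x by rewrite lt_neqAle eq_sym x0 nm_ge0.
  exists ((nm x)^-1%:C%C *: x).
  rewrite (linZ lf) !nmZ nmR ger0_norm ?invr_ge0 ?nm_ge0 // mulVf //; split=> //.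
  by rewrite ltr_pdivlMl // mulrC.
pose w n := f (v n).
have w_gt0 n : 0 < nm (w n).
  by apply: le_lt_trans (hv n).2; rewrite !mulr_ge0 // exprn_ge0.
pose y n := (9 ^- n / nm (w n))%:C%C *: w n.
have y_coef n : 0 <= 9 ^- n / nm (w n).
  by rewrite divr_ge0 ?nm_ge0 // invr_ge0 exprn_ge0.
have ny n : nm (y n) = 9 ^- n.
  by rewrite nmZ nmR ger0_norm // divfK // gt_eqF.
have wy n : nm (ip (w n) (y n)) = 9 ^- n * nm (w n).
  by rewrite nm_ip_scaled // expr2 mulrA divfK // gt_eqF.
(* A sign suffices: <w, x + y> and <w, x - y> differ by 2 <w, y>, so one of them is at least as
   large as <w, y>. *)
have [s hs] : {s : nat -> F -> R[i] & forall n x, nm (s n x) = 1 /\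
    9 ^- n * nm (w n) <= nm (ip (w n) (x + s n x *: y n))}.
  have : forall nx : nat * F, exists c : R[i], nm c = 1 /\
      9 ^- nx.1 * nm (w nx.1) <= nm (ip (w nx.1) (nx.2 + c *: y nx.1)).
    move=> [n x] /=.
    have n1 : nm (1 : R[i]) = 1 by rewrite /nm normr1.
    have [h|h] := leP (9 ^- n * nm (w n)) (nm (ip (w n) (x + 1 *: y n))).
      by exists 1.
    exists (-1); rewrite nmN; split=> //; rewrite leNgt; apply/negP => h'.
    have e : 2 *: ip (w n) (y n) = ip (w n) (x + 1 *: y n) - ip (w n) (x + -1 *: y n).
      rewrite scale1r scaleN1r ipDr ipBr opprB scaler_nat mulr2n.
      by rewrite [RHS](AC (2*2) (1*4*(2*3))) /= subrr add0r.
    have := le_lt_trans (nmB _ _) (ltrD h h'); rewrite -e nmZ wy.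
    have -> : nm (2 : R[i]) = 2 by rewrite -(rmorph_nat (real_complex R)) nmR normr_nat.
    lra.
  move=> /choice [s hs]; exists (fun n x => s (n, x)) => n x; exact: (hs (n, x)).
pose u := fix u n := if n is m.+1 then u m + s m (u m) *: y m else 0.
have r01 : 0 <= (9^-1 : R) < 1 by apply/andP; split; lra.
have du n : nm (u n.+1 - u n) <= 1 * 9^-1 ^+ n.
  by rewrite /= addrC addKr nmZ (hs _ _).1 !mul1r ny exprVn.
have [x _ hx] := geometric_cvg r01 du.
have low n : n.+1%:R < nm (g x).
  have h1 : nm (ip (w n) x) <= 4 * nm (g x).
    by rewrite /w fg; apply: le_trans (nm_ip_le _ _) _; rewrite (hv n).1 mul1r.
  have h2 : nm (ip (w n) (u n.+1 - x)) <= 9 ^- n * nm (w n) / 2.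
    apply: le_trans (nm_ip_le _ _) _; rewrite nmBC.
    have := ler_wpM2l (nm_ge0 (w n)) (hx n.+1).
    rewrite exprS exprVn; set a := 9 ^- n; set b := nm (w n); set c := nm (_ - _).
    have -> : 1 * (9^-1 * a) / (1 - 9^-1) = a / 8 by field.
    by rewrite (mulrC a b) !mulrA; lra.
  have h3 := (hs n (u n)).2; rewrite -/(u n.+1) in h3.
  have h4 : nm (ip (w n) (u n.+1)) <= nm (ip (w n) x) + nm (ip (w n) (u n.+1 - x)).
    by rewrite ipBr; apply: le_trans (nmD _ _); rewrite addrC subrK.
  have h5 : 8 * n.+1%:R < 9 ^- n * nm (w n).
    by rewrite ltr_pdivlMl ?exprn_gt0 // mulrC; exact: (hv n).2.
  lra.
have := low (Num.truncn (nm (g x))).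
by rewrite ltNge ltW // truncnS_gt.
Qed.

(** From [|g x|^2 = |<f (g x), x>|]; the factor 4 is that of [nm_ip_le]. *)
Lemma adjoint_norm_le f g (e : R) : 0 <= e -> adjoint_pair f g ->
  (forall x, nm (f x) <= e * nm x) -> forall x, nm (g x) <= 4 * e * nm x.
Proof.
move=> e0 fg hf x; have [g0|g0] := eqVneq (nm (g x)) 0.
  by rewrite g0 !mulr_ge0 // nm_ge0.
have g_gt0 : 0 < nm (g x) by rewrite lt_neqAle eq_sym g0 nm_ge0.
rewrite -(ler_pM2r g_gt0) -expr2 -nm_ip -fg.
apply: le_trans (nm_ip_le _ _) _.
have := ler_wpM2r (nm_ge0 x) (hf (g x)); nra.
Qed.

End Adjointable.

Lemma cvg_big_sum (R : realType) (I : Type) (r : seq I) (f : I -> nat -> R)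
    (l : I -> R) :
  (forall i, f i @ \oo --> l i) ->
  (fun n => \sum_(i <- r) f i n) @ \oo --> \sum_(i <- r) l i.
Proof.
move=> h; elim: r => [|i r ih].
  rewrite big_nil; under eq_fun do rewrite big_nil; exact: cvg_cst.
rewrite big_cons; under eq_fun do rewrite big_cons; exact: cvgD.
Qed.

Lemma Re_sum (R : realType) (I : Type) (r : seq I) (f : I -> R[i]) :
  complex.Re (\sum_(i <- r) f i) = \sum_(i <- r) complex.Re (f i).
Proof.
elim: r => [|i r ih]; first by rewrite !big_nil.
by rewrite !big_cons ReD ih.
Qed.

(** * Formal sums of elementary tensors and operators on them *)

Section FormalTensors.
Variables (R : realType) (M : cstar_algebra R) (E : tensor_powers M).
Variables (X : forall n, set (E n)) (F : hilbert_module M).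
Variable co : forall n, F -> E n.
Hypothesis hF : fock_space X co.
Hypothesis X0 : forall n, X (0 : E n).
Variables (H : hilbert R) (sigma : M -> H -> H).
Hypothesis hs : representation sigma.
Variable K : hilbert_tensors E sigma.

(* A list of pairs (x, h) stands for the element \sum x (x) h of F (x)_sigma H;
   tev n is its component in E^{(x) n} (x)_sigma H. *)
Definition tsum := seq (F * H).
Implicit Types u v w : tsum.

Definition tform u v : R[i] :=
  \sum_(a <- u) \sum_(b <- v) dot a.2 (sigma (ip a.1 b.1) b.2).

Definition tQ u : R := complex.Re (tform u u).

Definition tscale (c : R[i]) u : tsum := [seq (a.1, c *: a.2) | a <- u].

Definition tsub u v : tsum := u ++ tscale (-1) v.

(** The operator [f (x) I_H]. *)
Definition tapp (f : F -> F) u : tsum := [seq (f a.1, a.2) | a <- u].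

Definition tev n u : K n := \sum_(a <- u) htens K (co n a.1) a.2.

Lemma htens_linl n h : linear (fun x : E n => htens K x h).
Proof. by move=> k x y; exact: htens_linearl. Qed.

Lemma htens_linr n (x : E n) : linear (htens K x).
Proof. by move=> k h g; exact: htens_linearr. Qed.

Lemma formDr u v w : tform u (v ++ w) = tform u v + tform u w.
Proof. by rewrite /tform -big_split; apply: eq_bigr => a _; rewrite big_cat. Qed.

Lemma formC u v : tform u v = (tform v u)^*.
Proof.
rewrite /tform exchange_big [RHS](rmorph_sum (@Num.conj R[i])) /=.
apply: eq_bigr => a _; rewrite [RHS](rmorph_sum (@Num.conj R[i])) /=.
apply: eq_bigr => b _.
by rewrite -dot_conj -[in RHS]ip_star (rep_adj hs).
Qed.

Lemma formZr u c v : tform u (tscale c v) = c * tform u v.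
Proof.
rewrite /tform big_distrr; apply: eq_bigr => a _; rewrite big_map big_distrr.
by apply: eq_bigr => b _; rewrite /= (linZ (rep_lin hs _)) dotZr.
Qed.

Lemma formZl u c v : tform (tscale c u) v = c^* * tform u v.
Proof. by rewrite formC formZr cjM -formC. Qed.

Lemma formBr u v w : tform u (tsub v w) = tform u v - tform u w.
Proof. by rewrite formDr formZr mulN1r. Qed.

Lemma form_app f g u v : adjoint_pair f g ->
  tform (tapp f u) v = tform u (tapp g v).
Proof.
move=> fg; rewrite /tform big_map; apply: eq_bigr => a _; rewrite big_map.
by apply: eq_bigr => b _; rewrite /= fg.
Qed.

Lemma evD n u v : tev n (u ++ v) = tev n u + tev n v.
Proof. by rewrite /tev big_cat. Qed.

Lemma evZ n c u : tev n (tscale c u) = c *: tev n u.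
Proof.
rewrite /tev big_map scaler_sumr; apply: eq_bigr => a _.
exact: (linZ (htens_linr _)).
Qed.

Lemma evB n u v : tev n (tsub u v) = tev n u - tev n v.
Proof. by rewrite evD evZ scaleN1r. Qed.

Lemma dot_ev n u v :
  dot (tev n u) (tev n v) =
  \sum_(a <- u) \sum_(b <- v) dot a.2 (sigma (ip (co n a.1) (co n b.1)) b.2).
Proof.
rewrite dot_suml; apply: eq_bigr => a _; rewrite dot_sumr.
by apply: eq_bigr => b _; rewrite htens_dot.
Qed.

(** This is the source of positivity of [tform]: the components [tev n u] lie in Hilbert spaces,
    where squares are nonnegative. Convergence is inherited from [fock_ip] because [sigma] is
    contractive. *)
Lemma form_cvg u v :
  (fun N => \sum_(n < N) complex.Re (dot (tev n u) (tev n v))) @ \oo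
    --> complex.Re (tform u v).
Proof.
have -> : (fun N => \sum_(n < N) complex.Re (dot (tev n u) (tev n v))) =
  (fun N => \sum_(a <- u) \sum_(b <- v) complex.Re (dot a.2
     (sigma (series (fun n => ip (co n a.1) (co n b.1)) N) b.2))).
  apply/funext => N; under eq_bigr do rewrite dot_ev Re_sum.
  rewrite exchange_big; apply: eq_bigr => a _.
  under eq_bigr do rewrite Re_sum.
  rewrite exchange_big; apply: eq_bigr => b _.
  by rewrite /series /= (lin_sum (rep_linl hs _)) dot_sumr Re_sum big_mkord.
rewrite Re_sum; apply: cvg_big_sum => a; rewrite Re_sum; apply: cvg_big_sum => b.
apply/cvgrPdist_lt => e e0.
pose c := nm a.2 * nm b.2 + 1.
have c0 : 0 < c by rewrite ltr_wpDl // mulr_ge0 // nm_ge0.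
have [|N hN] := (cvg_nmP _ _).1 (fock_ip hF (x := a.1) (y := b.1)) (e / c).
  by rewrite divr_gt0.
exists N => // n /= /hN; set s := series _ n => hn.
rewrite -ReN -ReD -dotBr -(linB (rep_linl hs _)).
apply: le_lt_trans (Re_le_nm _) _; apply: le_lt_trans (cauchy_schwarz _ _) _.
have := rep_contractive hs (ip a.1 b.1 - s) b.2.
move/(ler_wpM2l (nm_ge0 a.2)) => /le_lt_trans; apply.
move: hn; rewrite ltr_pdivlMr //; apply: le_lt_trans.
by rewrite mulrCA ler_wpM2l ?nm_ge0 // /c lerDl.
Qed.

Lemma Q_ge0 u : 0 <= tQ u.
Proof.
have cv := @form_cvg u u.
apply: (@cvgr_to_ge _ _ _ R _ _ _ cv).
apply: nearW => N.
by apply: sumr_ge0 => n _; rewrite Re_dot sqr_ge0.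
Qed.

Lemma form_ge0 u : 0 <= tform u u.
Proof.
have := formC u u; have := Q_ge0 u; rewrite /tQ; case: (tform u u) => a b /= a0 [].
by move=> b0; rewrite lecE /= a0 andbT; apply/eqP; lra.
Qed.

Lemma form_cauchy_schwarz u v : nm (tform u v) ^+ 2 <= tQ u * tQ v.
Proof.
exact: (semi_cauchy_schwarz formDr formZr formC form_ge0).
Qed.

Lemma Q_scale c u : tQ (tscale c u) = nm c ^+ 2 * tQ u.
Proof.
rewrite /tQ formZl formZr mulrA -ReZ; congr complex.Re; congr (_ * _).
by rewrite mulrC -normCK nmE -rmorphXn.
Qed.

Definition homog k u := forall a, a \in u -> forall l, l <> k -> co l a.1 = 0.

Lemma homog_cat k u v : homog k u -> homog k v -> homog k (u ++ v).
Proof. by move=> hu hv a; rewrite mem_cat => /orP[/hu|/hv]. Qed.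

Lemma homog_scale k c u : homog k u -> homog k (tscale c u).
Proof. by move=> hu a /mapP [b bu ->]; exact: (hu b bu). Qed.

Lemma homog_sub k u v : homog k u -> homog k v -> homog k (tsub u v).
Proof. by move=> hu hv; exact: (@homog_cat k u _ hu (@homog_scale k _ v hv)). Qed.

Lemma summand_ip k x y : (forall l, l <> k -> co l x = 0) ->
  ip x y = ip (co k x) (co k y).
Proof.
move=> hx; apply/eqP; rewrite -subr_eq0; apply/eqP.
apply: (@nm_small0 _ _ _ 1) => // e e0; rewrite mul1r.
have [N hN] := (cvg_nmP _ _).1 (fock_ip hF (x := x) (y := y)) _ e0.
have kN : (k < maxn N k.+1)%N by rewrite leq_maxr.
have := hN (maxn N k.+1) (leq_maxl _ _).
rewrite /series /= big_mkord (bigD1 (Ordinal kN)) //= big1 ?addr0; first by move/ltW.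
move=> i ik; rewrite hx ?ip0l // => ik'; move/eqP: ik; apply.
by apply: val_inj.
Qed.

Lemma form_homog k u v : homog k u -> tform u v = dot (tev k u) (tev k v).
Proof.
move=> hu; rewrite dot_ev; apply: eq_big_seq => a au.
by apply: eq_bigr => b _; rewrite (summand_ip _ (hu a au)).
Qed.

Lemma Q_homog k u : homog k u -> tQ u = nm (tev k u) ^+ 2.
Proof. by move=> hu; rewrite /tQ (form_homog u hu) Re_dot. Qed.

Lemma form_orth k l u v : homog k u -> homog l v -> k <> l -> tform u v = 0.
Proof.
move=> hu hv kl; rewrite (form_homog v hu) /tev [X in dot _ X]big1_seq ?dot0r //.
by move=> a /= av; rewrite (hv a av k kl) (lin0 (htens_linl _)).
Qed.

Lemma summand_exists k (y : E k) : X y -> exists x, in_summand co y x.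
Proof.
(* The only nonzero entry has to be transported along [k = n]; [eq_axiomK] removes the cast at
   [n = k]. *)
move=> Xy; pose z n : E n :=
  if pselect (k = n) is left e then ecast n (E n) e y else 0.
have zk : z k = y.
  by rewrite /z; case: pselect => // e; rewrite eq_axiomK.
have zl l : l <> k -> z l = 0.
  by move=> lk; rewrite /z; case: pselect => // e; case: lk.
have [||x hx] := fock_surj hF (z := z).
- move=> n; rewrite /z; case: pselect => // e; by case: _ / e.
- apply/cvg_ex; exists (ip y y); apply/cvg_nmP => e e0; exists k.+1 => n kn.
  rewrite /series /= big_mkord (bigD1 (Ordinal kn)) //= big1 ?addr0 ?zk ?subrr ?nm0 //.
  move=> i ik; rewrite zl ?ip0l // => ik'; move/eqP: ik; apply.
  by apply: val_inj.
exists x; split; first by rewrite hx.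
by move=> l lk; rewrite hx zl.
Qed.

(** A crude bound that depends on the list itself. It only has to show geometric growth in
    [Q_app_le], where [power_trick] removes its value. *)
Definition tnorm u : R := \sum_(a <- u) nm a.1 * nm a.2.

Lemma tnorm_ge0 u : 0 <= tnorm u.
Proof. by apply: sumr_ge0 => a _; rewrite mulr_ge0 // nm_ge0. Qed.

Lemma form_tnorm u v : nm (tform u v) <= 4 * tnorm u * tnorm v.
Proof.
rewrite /tnorm -mulrA big_distrl big_distrr /=.
apply: le_trans (nm_sum _ _) _; apply: ler_sum => a _.
rewrite big_distrr big_distrr /=.
apply: le_trans (nm_sum _ _) _; apply: ler_sum => b _.
apply: le_trans (cauchy_schwarz _ _) _.
apply: (@le_trans _ _ (nm a.2 * (4 * (nm a.1 * nm b.1) * nm b.2))).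
  rewrite ler_wpM2l ?nm_ge0 //; apply: le_trans (rep_contractive hs _ _) _.
  by rewrite ler_wpM2r ?nm_ge0 // nm_ip_le.
by rewrite le_eqVlt; apply/orP; left; apply/eqP; ring.
Qed.

Lemma tnorm_app_iter f c n u : 0 <= c -> (forall x, nm (f x) <= c * nm x) ->
  tnorm (tapp (iter n f) u) <= c ^+ n * tnorm u.
Proof.
move=> c0 fc; rewrite /tnorm big_map big_distrr /=; apply: ler_sum => a _.
rewrite mulrA ler_wpM2r ?nm_ge0 //=; elim: n => [|n ih]; first by rewrite expr0 mul1r.
rewrite iterS exprS -mulrA; apply: le_trans (fc _) _; exact: ler_wpM2l.
Qed.

Lemma app_comp f g u : tapp f (tapp g u) = tapp (f \o g) u.
Proof. by rewrite /tapp -map_comp. Qed.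

(* With [b = g f] selfadjoint, [t k = <u, b^k u>] satisfies
   [t k ^ 2 <= <u, u> t (2 k)] and grows at most like [c ^ k]. *)
Lemma Q_app_le f g c u : 0 <= c -> adjoint_pair f g ->
  (forall x, nm (g (f x)) <= c * nm x) -> tQ (tapp f u) <= c * tQ u.
Proof.
move=> c0 fg hc; pose b := g \o f.
have bb n : adjoint_pair (iter n b) (iter n b).
  by apply: adjoint_iter; apply: adjoint_comp => //; exact: adjoint_sym.
pose t j := complex.Re (tform u (tapp (iter (2 ^ j) b) u)).
rewrite [leRHS]mulrC.
have -> : tQ (tapp f u) = t 0%N by rewrite /t /tQ (form_app _ _ fg) app_comp.
apply: (@power_trick _ _ _ (4 * tnorm u * tnorm u)) => // [|j|j].
- exact: Q_ge0.
- apply: (@le_trans _ _ (nm (tform u (tapp (iter (2 ^ j) b) u)) ^+ 2)).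
    by rewrite -real_normK ?num_real // lerXn2r ?nnegrE ?nm_ge0 // Re_le_nm.
  apply: le_trans (form_cauchy_schwarz _ _) _.
  rewrite /t {2}/tQ (form_app _ _ (bb _)) app_comp.
  rewrite expnS mul2n -addnn (_ : iter _ b \o _ = iter (2 ^ j + 2 ^ j) b) //.
  by apply/funext => x /=; rewrite iterD.
- apply: le_trans (ler_norm _) _; apply: le_trans (Re_le_nm _) _.
  apply: le_trans (form_tnorm _ _) _; rewrite -[leRHS]mulrA ler_wpM2l //.
    by rewrite mulr_ge0 // tnorm_ge0.
  by rewrite [leRHS]mulrC; exact: tnorm_app_iter.
Qed.

Lemma Q_app_bounded f g : adjoint_pair f g ->
  exists2 C : R, 0 < C & forall u, tQ (tapp f u) <= C * tQ u.
Proof.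
move=> fg; have [C1 C10 hC1] := adjointable_bounded fg.
have [C2 C20 hC2] := adjointable_bounded (adjoint_sym fg).
exists (C2 * C1); first by rewrite mulr_gt0.
move=> u; apply: (Q_app_le _ _ fg); first by rewrite mulr_ge0 // ltW.
by move=> x; apply: le_trans (hC2 _) _; rewrite -mulrA ler_pM2l.
Qed.

End FormalTensors.

(* A record, so that the limit does not get unfolded by implicit arguments. *)
Record null (R : realType) (a : nat -> R) : Prop := Null {
  null_cvg : a @ \oo --> (0 : R) }.

(** * Null sequences and window means *)

Section Null.
Variable R : realType.
Implicit Types a b : nat -> R.

Lemma null_le a b : (forall n, 0 <= b n <= a n) -> null a -> null b.
Proof.
move=> h [a0]; constructor.
apply: (@squeeze_cvgr _ _ _ _ (fun=> 0) a) => //; last exact: cvg_cst.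
exact: nearW.
Qed.

Lemma nullD a b : null a -> null b -> null (fun n => a n + b n).
Proof. by move=> [a0] [b0]; constructor; rewrite -[0](addr0 0); exact: cvgD. Qed.

Lemma nullZ c a : null a -> null (fun n => c * a n).
Proof. by move=> [a0]; constructor; rewrite -(mulr0 c); exact: cvgMr. Qed.

Lemma null_sqr a : null a -> null (fun n => a n ^+ 2).
Proof.
move=> [a0]; constructor; rewrite -(mulr0 (0 : R)).
under eq_fun do rewrite expr2; exact: cvgM.
Qed.

Lemma null_shift a n : null a -> null (fun k => a (n + k)%N).
Proof.
move=> [a0]; constructor.
have -> : (fun k => a (n + k)%N) = (fun k => a (k + n)%N).
  by apply/funext => k; rewrite addnC.
by rewrite (@cvg_shiftn _ _ a).
Qed.

Lemma null_inv : null (fun n => n.+1%:R^-1 : R).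
Proof. constructor; exact: cvg_harmonic. Qed.

Lemma null_div (c : R) : null (fun n => c / n%:R).
Proof.
have [h] := nullZ c null_inv.
by constructor; rewrite -(@cvg_shiftS _ (fun n => c / n%:R)).
Qed.

Lemma cvg_null a (l : R) : null (fun n => `|a n - l|) -> a @ \oo --> l.
Proof.
move=> [h]; apply/cvgrPdist_lt => e e0.
move/cvgrPdist_lt: h => /(_ _ e0) [N _ hN]; exists N => // n /hN /=.
by rewrite sub0r normrN normr_id distrC.
Qed.

(** All indices of the window are at least [N], so once [N] is large every term is within [e] of
    [l], and so is the mean. The bound [N.+1] in the proof keeps the divisor nonzero. *)
Lemma window_mean a (l : R) : a @ \oo --> l ->
  (fun N => (\sum_(k <- iota N N) a k) / N%:R) @ \oo --> l.
Proof.
move=> al; apply/cvgrPdist_le => e e0.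
move/cvgrPdist_le: al => /(_ _ e0) [N _ hN]; exists N.+1 => // n /= Nn.
have n0 : 0 < n%:R :> R by rewrite ltr0n (leq_trans _ Nn).
have -> : l - (\sum_(k <- iota n n) a k) / n%:R =
    (\sum_(k <- iota n n) (l - a k)) / n%:R.
  rewrite sumrB big_const_seq count_predT size_iota iter_addr_0 -(mulr_natr l n).
  by rewrite mulrBl mulfK // gt_eqF.
rewrite normrM normfV (ger0_norm (ltW n0)) ler_pdivrMr //.
apply: le_trans (ler_norm_sum _ _ _) _.
apply: (@le_trans _ _ (\sum_(k <- iota n n) e)).
  rewrite big_seq [leRHS]big_seq; apply: ler_sum => k.
  by rewrite mem_iota => /andP[nk _]; apply: hN => /=; apply: leq_trans nk; exact: ltnW.
by rewrite big_const_seq count_predT size_iota iter_addr_0 -(mulr_natr e n) mulrC.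
Qed.

End Null.

(** * Asymptotic equality of sequences of formal tensors *)

Section Asymptotics.
Variables (R : realType) (M : cstar_algebra R) (E : tensor_powers M).
Variables (X : forall n, set (E n)) (F : hilbert_module M).
Variable co : forall n, F -> E n.
Hypothesis hF : fock_space X co.
Variables (H : hilbert R) (sigma : M -> H -> H).
Hypothesis hs : representation sigma.
Variable K : hilbert_tensors E sigma.
Local Notation A := (tsum F H).
Local Notation form := (tform (F := F) sigma).
Local Notation Q := (tQ (F := F) sigma).
Implicit Types (u v w : A) (U V W : nat -> A).

Definition trf u v : R := complex.Re (form u v).

Lemma rfC u v : trf u v = trf v u.
Proof. by rewrite /trf (formC hs) Re_conj. Qed.

Lemma rfDr u v w : trf u (v ++ w) = trf u v + trf u w.
Proof. by rewrite /trf formDr ReD. Qed.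

Lemma rfBr u v w : trf u (tsub v w) = trf u v - trf u w.
Proof. by rewrite /trf (formBr hs) ReD ReN. Qed.

Lemma rfDl u v w : trf (u ++ v) w = trf u w + trf v w.
Proof. by rewrite !(rfC _ w) rfDr. Qed.

Lemma rfBl u v w : trf (tsub u v) w = trf u w - trf v w.
Proof. by rewrite !(rfC _ w) rfBr. Qed.

Lemma Qrf u : Q u = trf u u.
Proof. by []. Qed.

Lemma Q_sub u v : Q (tsub u v) = Q u - 2 * trf u v + Q v.
Proof. by rewrite !Qrf rfBl !rfBr (rfC v u); ring. Qed.

Let Q_ge0 := @Q_ge0 _ _ _ _ _ _ hF _ _ hs K.

(** This and the next three are instances of the parallelogram law: the right side minus the left
    one is [Q] of the vector given to [Q_ge0]. *)
Lemma Q_sub_le u v : Q (tsub u v) <= 2 * Q u + 2 * Q v.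
Proof.
by have := Q_ge0 (u ++ v); rewrite Q_sub !Qrf rfDl !rfDr (rfC v u); lra.
Qed.

Lemma Q_le u v : Q u <= 2 * Q (tsub u v) + 2 * Q v.
Proof.
have := Q_ge0 (tsub u (v ++ v)).
rewrite !Q_sub !Qrf rfDl !rfDr; lra.
Qed.

Lemma Q_sub_trans u v w : Q (tsub u w) <= 2 * Q (tsub u v) + 2 * Q (tsub v w).
Proof.
have := Q_ge0 (tsub (u ++ w) (v ++ v)).
by rewrite !Q_sub !Qrf !(rfDl, rfDr) (rfC w u) (rfC w v); lra.
Qed.

Lemma Q_sub_cat u u' v v' :
  Q (tsub (u ++ u') (v ++ v')) <= 2 * Q (tsub u v) + 2 * Q (tsub u' v').
Proof.
have := Q_ge0 (tsub (tsub u v) (tsub u' v')).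
rewrite !Qrf !(rfBl, rfBr) !(rfDl, rfDr, rfBl, rfBr).
rewrite (rfC u' u) (rfC v u) (rfC v' u) (rfC u' v) (rfC v' v) (rfC v' u').
lra.
Qed.

(** [Q] is a squared seminorm, so dividing by [N] amounts to the normalization N^(-1/2) of V_N. *)
Record asym U V : Prop := Asym {
  asym_null : null (fun N => Q (tsub (U N) (V N)) / N%:R) }.

Lemma asym_of_le U V (B : nat -> R) :
  (forall N, Q (tsub (U N) (V N)) <= B N) -> null (fun N => B N / N%:R) -> asym U V.
Proof.
move=> h B0; constructor; apply: null_le B0 => N.
by rewrite divr_ge0 ?Q_ge0 ?ler0n //= ler_wpM2r ?invr_ge0 ?ler0n.
Qed.

Lemma asym_refl U : asym U U.
Proof.
apply: (@asym_of_le _ _ (fun=> 0)); last exact: null_div.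
by move=> N; rewrite Q_sub Qrf; lra.
Qed.

Lemma asym_sym U V : asym U V -> asym V U.
Proof.
move=> [h]; constructor; move: h; congr null; apply/funext => N.
by rewrite !Q_sub rfC; congr (_ / _); ring.
Qed.

Lemma asym_trans U V W : asym U V -> asym V W -> asym U W.
Proof.
move=> [h1] [h2].
apply: (@asym_of_le _ _ (fun N => 2 * Q (tsub (U N) (V N)) + 2 * Q (tsub (V N) (W N)))).
  by move=> N; exact: Q_sub_trans.
have := nullD (nullZ 2 h1) (nullZ 2 h2); congr null; apply/funext => N.
by rewrite [RHS]mulrDl -!mulrA.
Qed.

Lemma asym_cat U V U' V' : asym U V -> asym U' V' ->
  asym (fun N => U N ++ U' N) (fun N => V N ++ V' N).
Proof.
move=> [h1] [h2].
apply: (@asym_of_le _ _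
  (fun N => 2 * Q (tsub (U N) (V N)) + 2 * Q (tsub (U' N) (V' N)))).
  by move=> N; exact: Q_sub_cat.
have := nullD (nullZ 2 h1) (nullZ 2 h2); congr null; apply/funext => N.
by rewrite [RHS]mulrDl -!mulrA.
Qed.

Lemma app_sub f u v : tapp f (tsub u v) = tsub (tapp f u) (tapp f v) :> A.
Proof. by rewrite /tsub /tapp /tscale map_cat -!map_comp. Qed.

Lemma sc_cat c u v : tscale c (u ++ v) = tscale c u ++ tscale c v :> A.
Proof. exact: map_cat. Qed.

Lemma sc_sub c u v : tscale c (tsub u v) = tsub (tscale c u) (tscale c v) :> A.
Proof.
rewrite /tsub sc_cat; congr (_ ++ _); rewrite /tscale -!map_comp.
by apply: eq_map => -[x h] /=; rewrite !scalerA mulrC.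
Qed.

Lemma asym_scale c U V : asym U V ->
  asym (fun N => tscale c (U N)) (fun N => tscale c (V N)).
Proof.
move=> [h]; constructor; have := nullZ (nm c ^+ 2) h; congr null; apply/funext => N.
by rewrite -sc_sub (Q_scale hs) mulrA.
Qed.

Lemma asym_app f g U V : adjoint_pair f g -> asym U V ->
  asym (fun N => tapp f (U N)) (fun N => tapp f (V N)).
Proof.
move=> fg [h]; have [C C0 hC] := Q_app_bounded hF hs K fg.
apply: (@asym_of_le _ _ (fun N => C * Q (tsub (U N) (V N)))).
  by move=> N; rewrite -app_sub.
by have := nullZ C h; congr null; apply/funext => N; rewrite mulrA.
Qed.

(* [represents a U]: up to vectors of seminorm zero, [U N] is the sum of the
   [a k] over the window [N <= k < 2 N]. *)
Definition represents (a : nat -> A) U :=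
  forall N w, form w (U N) = \sum_(k <- iota N N) form w (a k).

Definition window (a : nat -> A) N : A := flatten [seq a k | k <- iota N N].

Lemma form_flatten (a : nat -> A) (r : seq nat) w :
  form w (flatten [seq a k | k <- r]) = \sum_(k <- r) form w (a k).
Proof.
elim: r => [|k r ih] /=.
  by rewrite big_nil /tform; rewrite big1 // => i _; rewrite big_nil.
by rewrite formDr ih big_cons.
Qed.

Lemma represents_window a : represents a (window a).
Proof. by move=> N w; rewrite form_flatten. Qed.

(** Terms of different index have different degrees, hence are orthogonal, and only the diagonal
    survives. The degree map [d] allows for windows moved by a shift, where [d k = n + k]. *)
Lemma form_windows (d : nat -> nat) a b U V N : injective d ->
  represents a U -> represents b V ->
  (forall k, homog co (d k) (a k)) -> (forall k, homog co (d k) (b k)) ->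
  form (U N) (V N) = \sum_(k <- iota N N) form (a k) (b k).
Proof.
move=> dinj Ua Vb ha hb; rewrite Vb; apply: eq_big_seq => k kN.
rewrite (formC hs) Ua [in LHS](bigD1_seq k) ?iota_uniq //= big1 ?addr0.
  by rewrite -(formC hs).
move=> l lk; apply: (form_orth hF K (hb k) (ha l)) => /dinj kl.
by rewrite kl eqxx in lk.
Qed.

(** By orthogonality [Q (tsub (U N) (V N)) / N] is the window mean of the termwise values, a null
    sequence. *)
Lemma asym_windows (d : nat -> nat) a b U V : injective d ->
  represents a U -> represents b V ->
  (forall k, homog co (d k) (a k)) -> (forall k, homog co (d k) (b k)) ->
  null (fun k => Q (tsub (a k) (b k))) -> asym U V.
Proof.
move=> dinj Ua Vb ha hb [h]; constructor; constructor.
have -> : (fun N => Q (tsub (U N) (V N)) / N%:R) =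
    (fun N => (\sum_(k <- iota N N) Q (tsub (a k) (b k))) / N%:R); last first.
  exact: window_mean h.
apply/funext => N; congr (_ / _); rewrite /tQ -Re_sum; congr complex.Re.
apply: (@form_windows d (fun k => tsub (a k) (b k)) (fun k => tsub (a k) (b k))
  (fun N => tsub (U N) (V N)) (fun N => tsub (U N) (V N))) => //.
- move=> n w; rewrite (formBr hs) Ua Vb -sumrB.
  by apply: eq_bigr => k _; rewrite (formBr hs).
- move=> n w; rewrite (formBr hs) Ua Vb -sumrB.
  by apply: eq_bigr => k _; rewrite (formBr hs).
- by move=> k; apply: homog_sub.
- by move=> k; apply: homog_sub.
Qed.

Lemma Q_flatten_le (a : nat -> A) (B : R) i n : (forall k, homog co k (a k)) ->
  (forall k, Q (a k) <= B) -> Q (flatten [seq a k | k <- iota i n]) <= n%:R * B.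
Proof.
move=> ha hB; rewrite /tQ form_flatten.
have -> : \sum_(k <- iota i n) form (flatten [seq a k | k <- iota i n]) (a k) =
    \sum_(k <- iota i n) form (a k) (a k).
  apply: eq_big_seq => k kN.
  rewrite (formC hs) form_flatten [in LHS](bigD1_seq k) ?iota_uniq //= big1 ?addr0.
    by rewrite -(formC hs).
  move=> l lk; apply: (form_orth hF K (ha k) (ha l)) => kl.
  by rewrite kl eqxx in lk.
rewrite Re_sum; apply: le_trans (ler_sum _ (fun k _ => hB k)) _.
by rewrite big_const_seq count_predT size_iota iter_addr_0 -(mulr_natl B n).
Qed.

(* Two windows shifted by [n] differ by at most [2 n] terms. *)
Lemma asym_window_shift (a : nat -> A) (B : R) n : (forall k, homog co k (a k)) ->
  (forall k, Q (a k) <= B) -> asym (window (fun k => a (n + k)%N)) (window a).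
Proof.
move=> ha hB; apply: (@asym_of_le _ _ (fun=> 4 * (n%:R * B))); last exact: null_div.
move=> N; set P' := window _ N; set P := window _ N.
pose S0 := flatten [seq a k | k <- iota N n].
pose S1 := flatten [seq a k | k <- iota (N + N) n].
(* Both sides run over the indices of [N, 2N + n), split after [N] or after [n] entries; so P' - P
   equals S1 - S0 up to null vectors. *)
have S01 : P ++ S1 = S0 ++ P'.
  rewrite /P /S1 /window -flatten_cat -map_cat -iotaD addnC iotaD map_cat.
  rewrite flatten_cat; congr (_ ++ flatten _).
  by rewrite addnC iotaDl -map_comp.
have form_P' w : trf w P' = trf w P + trf w S1 - trf w S0.
  by have := rfDr w P S1; rewrite S01 rfDr => <-; ring.
have : Q (tsub S1 S0) <= 2 * Q S1 + 2 * Q S0 by exact: Q_sub_le.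
have -> : Q (tsub P' P) = Q (tsub S1 S0).
  rewrite !Q_sub !Qrf form_P' !(rfC _ P) form_P' (rfC P' S1) (rfC P' S0) !form_P'.
  by rewrite !(rfC _ P) (rfC S0 S1); ring.
have := @Q_flatten_le a B N n ha hB.
have := @Q_flatten_le a B (N + N)%N n ha hB.
rewrite -/S0 -/S1; lra.
Qed.

End Asymptotics.

(* limsup a <= l *)
Record eventually_le (R : realType) (a : nat -> R) (l : R) : Prop := EventuallyLe {
  ev_le : forall e, 0 < e -> exists N, forall n, (N <= n)%N -> a n <= l + e }.

(** * Asymptotic upper bounds *)

Section EventuallyLe.
Variable R : realType.
Implicit Types a b : nat -> R.

Lemma eventually_le_cvg a (l : R) : a @ \oo --> l -> eventually_le a l.
Proof.
move=> al; constructor=> e e0.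
move/cvgrPdist_le: al => /(_ _ e0) [N _ hN]; exists N => n /hN /=.
by rewrite ler_norml; lra.
Qed.

Lemma eventually_leD a b l m : eventually_le a l -> eventually_le b m ->
  eventually_le (fun n => a n + b n) (l + m).
Proof.
move=> [ha] [hb]; constructor=> e e0.
have e2 : 0 < e / 2 by rewrite divr_gt0.
have [N1 h1] := ha _ e2; have [N2 h2] := hb _ e2.
exists (maxn N1 N2) => n; rewrite geq_max => /andP[/h1 + /h2]; lra.
Qed.

Lemma eventually_leZ c a l : 0 < c -> eventually_le a l ->
  eventually_le (fun n => c * a n) (c * l).
Proof.
move=> c0 [ha]; constructor=> e e0.
have [N h] := ha (e / c) (divr_gt0 e0 c0); exists N => n /h.
by rewrite -(ler_pM2l c0) mulrDr [c * (e / c)]mulrC divfK ?gt_eqF.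
Qed.

Lemma eventually_le_le a b l : (forall n, b n <= a n) -> eventually_le a l ->
  eventually_le b l.
Proof.
move=> h [ha]; constructor=> e /ha [N hN]; exists N => n /hN.
exact: le_trans.
Qed.

Lemma eventually_le_lim a (l m : R) : a @ \oo --> m -> eventually_le a l -> m <= l.
Proof.
move=> am [ha]; apply/ler_addgt0Pr => e e0.
have e2 : 0 < e / 2 by rewrite divr_gt0.
move/cvgrPdist_le: am => /(_ _ e2) [N1 _ h1]; have [N2 h2] := ha _ e2.
have := h1 (maxn N1 N2) (leq_maxl _ _); have := h2 _ (leq_maxr N1 N2).
rewrite /= ler_norml; lra.
Qed.

Lemma null_of_eventually_le a : (forall n, 0 <= a n) ->
  (forall e, 0 < e -> eventually_le a e) -> null a.
Proof.
move=> a0 h; constructor; apply/cvgrPdist_le => e e0.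
have e2 : 0 < e / 2 by rewrite divr_gt0.
have [ha] := h _ e2; have [N hN] := ha _ e2; exists N => // n /hN /=.
by rewrite sub0r normrN ger0_norm //; lra.
Qed.

Lemma null_sqrt a : null a -> null (fun n => Num.sqrt (a n)).
Proof.
move=> [a0]; constructor; rewrite -(@sqrtr0 R).
by apply: (continuous_cvg _ _ a0); exact: sqrt_continuous.
Qed.

End EventuallyLe.

(** * Operators asymptotically intertwined by the window sums *)

Section WindowVectors.
Variables (R : realType) (M : cstar_algebra R) (E : tensor_powers M).
Variables (X : forall n, set (E n)) (F : hilbert_module M).
Variable co : forall n, F -> E n.
Hypothesis hF : fock_space X co.
Variables (H : hilbert R) (sigma : M -> H -> H).
Hypothesis hs : representation sigma.
Variable K : hilbert_tensors E sigma.
Local Notation A := (tsum F H).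
Local Notation form := (tform (F := F) sigma).
Local Notation Q := (tQ (F := F) sigma).
Local Notation rf := (trf (F := F) sigma).
Local Notation asym := (asym (F := F) sigma).
Local Notation ev := (tev co K).
Implicit Types (u v w : A) (U W : nat -> A) (h g : H) (xi eta : H).

Let Q_ge0 := @Q_ge0 _ _ _ _ _ _ hF _ _ hs K.

Lemma Q_homog_sub d u v : homog co d u -> homog co d v ->
  Q (tsub u v) = nm (ev d u - ev d v) ^+ 2.
Proof.
move=> hu hv; rewrite (Q_homog hF K (homog_sub hu hv)) (evB co K).
by [].
Qed.

(** Moves the comparison of formal sums into the spaces [K (d k)], which contain the exact vectors
    [x k] and [y k] that the sums approximate. *)
Lemma null_approx (d : nat -> nat) (a b : nat -> A) (x y : forall k, K (d k)) :
  (forall k, homog co (d k) (a k)) -> (forall k, homog co (d k) (b k)) ->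
  null (fun k => nm (ev (d k) (a k) - x k)) ->
  null (fun k => nm (ev (d k) (b k) - y k)) ->
  null (fun k => nm (x k - y k)) -> null (fun k => Q (tsub (a k) (b k))).
Proof.
move=> ha hb nx ny nxy.
apply: null_le (null_sqr (nullD nx (nullD nxy ny))) => k.
rewrite Q_ge0 (Q_homog_sub (@ha k) (@hb k)) /=.
apply: lerXn2r; rewrite ?nnegrE ?addr_ge0 ?nm_ge0 //.
rewrite -(subrKA (x k)); apply: le_trans (nmD _ _) _; rewrite lerD2l.
rewrite -(subrKA (y k)); apply: le_trans (nmD _ _) _; rewrite lerD2l.
by rewrite nmBC.
Qed.

(** [iso k] stands for W_k, and [om k h] for a formal sum approximating W_k h with an error that
    tends to 0. *)
Variable iso : forall k, H -> K k.
Hypothesis iso_lin : forall k, linear (iso k).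
Hypothesis iso_dot : forall k h g, dot (iso k h) (iso k g) = dot h g.
Variable om : nat -> H -> A.
Hypothesis om_homog : forall k h, homog co k (om k h).
Hypothesis om_close : forall k h, nm (ev k (om k h) - iso k h) <= k.+1%:R^-1.

(** N^(1/2) V_N h, up to the errors of [om]. *)
Definition wvec h : nat -> A := window (fun k => om k h).

Lemma nm_iso k h : nm (iso k h) = nm h.
Proof.
apply/eqP; rewrite -(@eqrXn2 _ 2) ?nm_ge0 //; apply/eqP.
by rewrite -!Re_dot iso_dot.
Qed.

Lemma null_close h : null (fun k => nm (ev k (om k h) - iso k h)).
Proof. by apply: null_le (null_inv R) => k; rewrite nm_ge0 om_close. Qed.

Lemma nm_ev_om k h : nm (ev k (om k h)) <= nm h + 1.
Proof.
rewrite -[ev k _](subrK (iso k h)) addrC; apply: le_trans (nmD _ _) _.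
rewrite nm_iso lerD2l; apply: le_trans (om_close k h) _.
by rewrite invf_le1 ?ltr0n // ler1n.
Qed.

Lemma Q_om_le k h : Q (om k h) <= (nm h + 1) ^+ 2.
Proof.
rewrite (Q_homog hF K (@om_homog k h)); apply: lerXn2r; rewrite ?nnegrE ?nm_ge0 //.
  by rewrite addr_ge0 // nm_ge0.
exact: nm_ev_om.
Qed.

(** V_N is isometric in the limit: the terms in degree [k] pair to a number tending to <h, g>, and
    so do their window means. *)
Lemma V_dot h g :
  (fun N => rf (wvec h N) (wvec g N) / N%:R) @ \oo --> complex.Re (dot h g).
Proof.
have -> : (fun N => rf (wvec h N) (wvec g N) / N%:R) = (fun N =>
    (\sum_(k <- iota N N) complex.Re (dot (ev k (om k h)) (ev k (om k g)))) / N%:R).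
  apply/funext => N; congr (_ / _); rewrite /trf -Re_sum; congr complex.Re.
  rewrite (@form_windows _ _ _ _ _ _ hF _ _ hs K id (fun k => om k h)
    (fun k => om k g)) //; try exact: represents_window.
  by apply: eq_bigr => k _; rewrite (form_homog hF K _ (@om_homog k h)).
apply: window_mean; apply: cvg_null.
apply: null_le (nullD (nullZ (nm g + 1) (null_close h)) (nullZ (nm h) (null_close g))).
move=> k; rewrite normr_ge0 /= -ReN -ReD -(iso_dot k h g).
set x := ev k _; set y := ev k _.
have -> : dot x y - dot (iso k h) (iso k g) =
    dot (x - iso k h) y + dot (iso k h) (y - iso k g).
  by rewrite dotBl dotBr addrA subrK.
rewrite ReD; apply: le_trans (ler_normD _ _) _; apply: lerD.
  apply: le_trans (Re_le_nm _) _; apply: le_trans (cauchy_schwarz _ _) _.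
  by rewrite mulrC ler_wpM2r ?nm_ge0 // nm_ev_om.
apply: le_trans (Re_le_nm _) _; apply: le_trans (cauchy_schwarz _ _) _.
by rewrite nm_iso.
Qed.

Lemma V_norm h : (fun N => Q (wvec h N) / N%:R) @ \oo --> nm h ^+ 2.
Proof. rewrite -Re_dot; exact: (@V_dot h h). Qed.

Lemma V_sub h g :
  (fun N => Q (tsub (wvec h N) (wvec g N)) / N%:R) @ \oo --> nm (h - g) ^+ 2.
Proof.
have -> : (fun N => Q (tsub (wvec h N) (wvec g N)) / N%:R) = (fun N =>
    Q (wvec h N) / N%:R - 2 * (rf (wvec h N) (wvec g N) / N%:R) + Q (wvec g N) / N%:R).
  by apply/funext => N; rewrite (Q_sub hs) mulrDl mulrBl -mulrA.
rewrite nm_sqrB; apply: cvgD; last exact: V_norm.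
apply: cvgB; first exact: V_norm.
by apply: cvgMr; exact: V_dot.
Qed.

Lemma asym_V_eq h g : asym (wvec h) (wvec g) -> h = g.
Proof.
move=> [[h0]]; apply/eqP; rewrite -subr_eq0; apply/eqP/nm_eq0/eqP.
by rewrite -sqrf_eq0 (cvg_unique _ (@V_sub h g) h0).
Qed.

(** [om k] is not assumed linear; linearity returns asymptotically from that of [iso k]. *)
Lemma V_lin c h g : asym (wvec (c *: h + g)) (fun N => tscale c (wvec h N) ++ wvec g N).
Proof.
apply: (@asym_windows _ _ _ _ _ _ hF _ _ hs K id (fun k => om k (c *: h + g))
  (fun k => tscale c (om k h) ++ om k g)) => //.
- exact: represents_window.
- move=> N w; rewrite formDr (formZr hs) !represents_window big_distrr -big_split.
  by apply: eq_bigr => k _; rewrite formDr (formZr hs).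
- move=> k; exact: (@homog_cat _ _ _ _ _ _ k _ _ (@homog_scale _ _ _ _ _ _ k c _
    (@om_homog k h)) (@om_homog k g)).
apply: (@null_approx id _ _ (fun k => iso k (c *: h + g))
  (fun k => iso k (c *: h + g))) => //.
- move=> k; exact: (@homog_cat _ _ _ _ _ _ k _ _ (@homog_scale _ _ _ _ _ _ k c _
    (@om_homog k h)) (@om_homog k g)).
- exact: null_close.
- apply: null_le (nullD (nullZ (nm c) (null_close h)) (null_close g)) => k.
  rewrite nm_ge0 /= (evD co K) (evZ co K) iso_lin opprD addrACA -scalerBr.
  by apply: le_trans (nmD _ _) _; rewrite nmZ.
by constructor; under eq_fun do rewrite subrr nm0; exact: cvg_cst.
Qed.

Lemma asym_form_eq U W : (forall N w, form w (U N) = form w (W N)) -> asym U W.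
Proof.
move=> e; apply: (@asym_of_le _ _ _ _ _ _ hF _ _ hs K _ _ (fun=> 0)) => [N|].
  by rewrite Qrf (rfBr hs) /trf e subrr.
exact: null_div.
Qed.

(** The graph of the future representation: [xi] is pi(f) h. *)
Definition tends (f : F -> F) h xi := asym (fun N => tapp f (wvec h N)) (wvec xi).

Lemma tends_unique f h xi eta : tends f h xi -> tends f h eta -> xi = eta.
Proof.
move=> h1 h2; apply: asym_V_eq.
exact: (asym_trans hF hs K (asym_sym hs h1) h2).
Qed.

Lemma tends_lin f f' c h g xi eta : adjoint_pair f f' ->
  tends f h xi -> tends f g eta -> tends f (c *: h + g) (c *: xi + eta).
Proof.
move=> ff h1 h2.
apply: (asym_trans hF hs K (asym_app hF hs K ff (V_lin c h g))).
apply: (asym_trans hF hs K _ (asym_sym hs (V_lin c xi eta))).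
have -> : (fun N => tapp f (tscale c (wvec h N) ++ wvec g N)) =
    (fun N => tscale c (tapp f (wvec h N)) ++ tapp f (wvec g N)).
  by apply/funext => N; rewrite /tapp /tscale map_cat -!map_comp.
by apply: (asym_cat hF hs K) => //; exact: asym_scale.
Qed.

Lemma tends_comp f f' f2 h xi eta : adjoint_pair f f' ->
  tends f2 h xi -> tends f xi eta -> tends (f \o f2) h eta.
Proof.
move=> ff h1 h2; apply: (asym_trans hF hs K _ h2).
have := asym_app hF hs K ff h1.
by congr (asym _ _); apply/funext => N; rewrite app_comp.
Qed.

Lemma form_app_combination c (f f2 : F -> F) w u :
  form w (tapp (fun x => c *: f x + f2 x) u) =
  c * form w (tapp f u) + form w (tapp f2 u).
Proof.
rewrite /tform big_distrr -big_split; apply: eq_bigr => a _ /=.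
rewrite !big_map big_distrr -big_split; apply: eq_bigr => b _ /=.
by rewrite ip_linear (repP hs) dot_linear.
Qed.

Lemma tends_combination f f2 c h xi eta :
  tends f h xi -> tends f2 h eta ->
  tends (fun x => c *: f x + f2 x) h (c *: xi + eta).
Proof.
move=> h1 h2; apply: (asym_trans hF hs K _ (asym_sym hs (V_lin c xi eta))).
apply: (asym_trans hF hs K _ (asym_cat hF hs K (asym_scale hs c h1) h2)).
apply: asym_form_eq => N w.
by rewrite form_app_combination formDr (formZr hs).
Qed.

Lemma tends0 h : tends (fun=> 0) h 0.
Proof.
have [h0] := asym_refl hF hs K (wvec 0); constructor; constructor.
have -> : (fun N => Q (tsub (tapp (fun=> 0) (wvec h N)) (wvec 0 N)) / N%:R) =
    (fun N => Q (wvec 0 N) / N%:R).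
  apply/funext => N; congr (_ / _).
  have e w : form w (tapp (fun=> 0) (wvec h N)) = 0.
    rewrite /tform big1 // => a _; rewrite big_map big1 // => b _ /=.
    by rewrite (lin0 (ip_linr _)) (lin0 (rep_linl hs _)) dot0r.
  by rewrite (Q_sub hs) rfC // Qrf /trf !e mulr0 subrr add0r.
have := @V_norm 0; by rewrite nm0 expr0n.
Qed.

(** Both sides are the limit of Re <f V_N h, V_N g>: by Cauchy-Schwarz, asymptotically equal vectors
    have the same limiting pairings with V_N g. *)
Lemma tends_Re_adjoint f f' h g xi eta : adjoint_pair f f' ->
  tends f h xi -> tends f' g eta ->
  complex.Re (dot xi g) = complex.Re (dot h eta).
Proof.
move=> ff h1 h2.
have lim U (k zeta : H) : asym U (wvec zeta) ->
    (fun N => rf (U N) (wvec k N) / N%:R) @ \oo --> complex.Re (dot zeta k).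
  move=> [hU].
  have -> : (fun N => rf (U N) (wvec k N) / N%:R) = (fun N =>
     rf (tsub (U N) (wvec zeta N)) (wvec k N) / N%:R
     + rf (wvec zeta N) (wvec k N) / N%:R).
    by apply/funext => N; rewrite (rfBl hs) -mulrDl subrK.
  rewrite -[complex.Re _]add0r; apply: cvgD; last exact: V_dot.
  apply: cvg_null.
  have : null (fun N =>
      Num.sqrt (Q (tsub (U N) (wvec zeta N)) / N%:R * (Q (wvec k N) / N%:R))).
    apply: null_sqrt; constructor; rewrite -(mul0r (nm k ^+ 2)).
    by apply: cvgM; [exact: null_cvg hU|exact: V_norm].
  apply: null_le => N; rewrite subr0 normr_ge0 /= -sqrtr_sqr ler_wsqrtr //.
  rewrite expr_div_n mulrACA -invfM -expr2 ler_wpM2r ?invr_ge0 ?sqr_ge0 //.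
  apply: le_trans (form_cauchy_schwarz hF hs K _ _).
  by rewrite -real_normK ?num_real // lerXn2r ?nnegrE ?nm_ge0 // Re_le_nm.
apply: cvg_unique (lim _ g _ h1) _ => //.
have -> : (fun N => rf (tapp f (wvec h N)) (wvec g N) / N%:R) =
    (fun N => rf (tapp f' (wvec g N)) (wvec h N) / N%:R).
  by apply/funext => N; rewrite [in RHS](rfC hs) /trf (form_app _ _ _ ff).
rewrite -Re_conj -dot_conj; exact: lim.
Qed.

(** The imaginary parts follow from the real ones with [h] replaced by ['i *: h]. *)
Lemma tends_adjoint f f' h g xi eta : adjoint_pair f f' ->
  tends f h xi -> tends f' g eta -> dot xi g = dot h eta.
Proof.
move=> ff h1 h2.
have [hf' h0] := (adjoint_linear (adjoint_sym ff), tends0).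
have t0 : tends f 0 0.
  have := tends_lin (-1) ff h1 h1; by rewrite !scaleN1r !addNr.
have := tends_lin 'i ff h1 t0; rewrite !addr0 => hi.
have := tends_Re_adjoint ff hi h2; rewrite !dotZl conjCi.
have := tends_Re_adjoint ff h1 h2.
rewrite -complexiE; case: (dot xi g) => a b; case: (dot h eta) => c d /= -> e.
by congr (_ +i* _)%C; lra.
Qed.

Lemma tends_bounded f (C : R) h xi : 0 < C -> (forall u, Q (tapp f u) <= C * Q u) ->
  tends f h xi -> nm xi ^+ 2 <= 2 * C * nm h ^+ 2.
Proof.
move=> C0 hC [hf]; apply: (eventually_le_lim (@V_norm xi)).
have -> : 2 * C * nm h ^+ 2 = 2 * 0 + 2 * (C * nm h ^+ 2) by ring.
have h1 := eventually_le_cvg (null_cvg hf).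
have h2 := eventually_le_cvg (@V_norm h).
apply: eventually_le_le (eventually_leD (eventually_leZ (ltr0n _ 2) h1)
  (eventually_leZ (ltr0n _ 2) (eventually_leZ C0 h2))) => N /=.
rewrite !mulrA -!mulrDl ler_wpM2r ?invr_ge0 ?ler0n //.
apply: le_trans (Q_le hF hs K (wvec xi N) (tapp f (wvec h N))) _.
have := hC (wvec h N); rewrite !(Q_sub hs) (rfC hs); lra.
Qed.

(** The limits for approximants of [f] form a Cauchy sequence, because V_N is asymptotically
    isometric, and completeness of [H] provides the limit for [f]. *)
Lemma tends_limit f f' h : adjoint_pair f f' ->
  (forall e, 0 < e -> exists g g' : F -> F, [/\ adjoint_pair g g',
     (forall x, nm (f x - g x) <= e * nm x) & exists xi, tends g h xi]) ->
  exists xi, tends f h xi.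
Proof.
move=> ff happ.
pose e (j : nat) : R := j.+1%:R^-1.
have e0 j : 0 < e j by rewrite invr_gt0 ltr0n.
(* If [|f - g| <= e] then (f - g)^* (f - g) is bounded by [4 e^2], with 4 from [adjoint_norm_le];
   [Q_sub_trans] doubles this. *)
have [xi hxi] : {xi : nat -> H & forall j, eventually_le
    (fun N => Q (tsub (tapp f (wvec h N)) (wvec (xi j) N)) / N%:R)
    (8 * e j ^+ 2 * nm h ^+ 2)}.
  apply: (@choice _ _ (fun j x => eventually_le
    (fun N => Q (tsub (tapp f (wvec h N)) (wvec x N)) / N%:R)
    (8 * e j ^+ 2 * nm h ^+ 2))) => j.
  have [g [g' [gg hg [xi [hxi]]]]] := happ _ (e0 j); exists xi.
  have dd : adjoint_pair (fun x => (-1) *: g x + f x) (fun x => (-1)^* *: g' x + f' x).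
    exact: adjoint_combination.
  have dn x : nm ((-1) *: g x + f x) <= e j * nm x by rewrite scaleN1r addrC.
  have dQ u : Q (tsub (tapp f u) (tapp g u)) <= 4 * e j * e j * Q u.
    have -> : Q (tsub (tapp f u) (tapp g u)) = Q (tapp (fun x => (-1) *: g x + f x) u).
      have D w : rf w (tapp (fun x => (-1) *: g x + f x) u) =
          rf w (tsub (tapp f u) (tapp g u)).
        by rewrite (rfBr hs) /trf form_app_combination ReD mulN1r ReN addrC.
      by rewrite [RHS]Qrf D (rfC hs) D.
    apply: (Q_app_le hF hs K _ _ dd); first by rewrite !mulr_ge0 // ltW.
    move=> x; apply: le_trans (adjoint_norm_le (ltW (e0 j)) dd dn _) _.
    by rewrite -[leRHS]mulrA ler_wpM2l ?mulr_ge0 // ltW.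
  have -> : 8 * e j ^+ 2 * nm h ^+ 2 = 2 * (4 * e j * e j * nm h ^+ 2) + 2 * 0 by ring.
  have c0 : 0 < 4 * e j * e j by rewrite !mulr_gt0.
  apply: eventually_le_le (eventually_leD
    (eventually_leZ (ltr0n _ 2) (eventually_leZ c0 (eventually_le_cvg (@V_norm h))))
    (eventually_leZ (ltr0n _ 2) (eventually_le_cvg (null_cvg hxi)))) => N /=.
  rewrite !mulrA -!mulrDl ler_wpM2r ?invr_ge0 ?ler0n //.
  apply: le_trans (Q_sub_trans hF hs K _ (tapp g (wvec h N)) _) _.
  by have := dQ (wvec h N); lra.
have small (d : R) : 0 < d -> exists N, forall j, (N <= j)%N ->
    e j ^+ 2 * nm h ^+ 2 < d.
  move=> d0; have [hn] := nullZ (nm h ^+ 2) (null_sqr (null_inv R)).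
  move/cvgrPdist_lt: hn => /(_ _ d0) [N _ hN]; exists N => j /hN /=.
  by rewrite sub0r normrN mulrC; apply: le_lt_trans; exact: ler_norm.
have dist i j : nm (xi i - xi j) ^+ 2 <=
    16 * (e i ^+ 2 * nm h ^+ 2) + 16 * (e j ^+ 2 * nm h ^+ 2).
  apply: (eventually_le_lim (@V_sub (xi i) (xi j))).
  have := eventually_leD (eventually_leZ (ltr0n _ 2) (hxi i))
    (eventually_leZ (ltr0n _ 2) (hxi j)).
  rewrite (_ : _ + _ = 16 * (e i ^+ 2 * nm h ^+ 2) + 16 * (e j ^+ 2 * nm h ^+ 2));
    last by ring.
  apply: eventually_le_le => N /=.
  rewrite !mulrA -!mulrDl ler_wpM2r ?invr_ge0 ?ler0n //.
  apply: le_trans (Q_sub_trans hF hs K _ (tapp f (wvec h N)) _) _.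
  by rewrite !(Q_sub hs) (rfC hs (wvec (xi i) N)); lra.
have [z hz] : exists z : H, xi @ \oo --> z.
  apply: nm_cauchy_cvg => d d0.
  have [|N hN] := small (d ^+ 2 / 32); first by rewrite divr_gt0 ?exprn_gt0.
  exists N => i j /hN hi /hN hj.
  rewrite -(@ltr_pXn2r _ 2) ?nnegrE ?nm_ge0 ?ltW //.
  by have := dist i j; lra.
exists z; constructor; apply: null_of_eventually_le => [N|d d0].
  by rewrite divr_ge0 ?Q_ge0 ?ler0n.
have d32 : 0 < d / 32 by rewrite divr_gt0.
have [N1 hN1] := small _ d32.
(* The minimum with 1 bounds the square of the distance by [d / 4] too; then 16 (d / 32) + 2 (d / 4)
   = d. *)
have d1 : 0 < Num.min 1 (d / 4) by rewrite lt_min ltr01 divr_gt0.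
have [N2 hN2] := (cvg_nmP _ _).1 hz _ d1.
pose j := maxn N1 N2.
have h1 := hN1 j (leq_maxl _ _); have := hN2 j (leq_maxr _ _).
rewrite lt_min => /andP[z1 z2].
have h2 : nm (xi j - z) ^+ 2 <= d / 4.
  rewrite nmBC expr2; apply: le_trans (ltW z2).
  by rewrite ler_piMr ?nm_ge0 // ltW.
have : 2 * (8 * e j ^+ 2 * nm h ^+ 2) + 2 * nm (xi j - z) ^+ 2 <= d by lra.
move=> hd; constructor=> c c0.
have [hev] := eventually_leD (eventually_leZ (ltr0n _ 2) (hxi j))
    (eventually_leZ (ltr0n _ 2) (eventually_le_cvg (@V_sub (xi j) z))).
have [N hN] := hev _ c0; exists N => n /hN hn.
apply: (@le_trans _ _ _ _ _ _ (le_trans hn _)); last by rewrite lerD2r.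
rewrite !mulrA -!mulrDl ler_wpM2r ?invr_ge0 ?ler0n //.
exact: (Q_sub_trans hF hs K).
Qed.

Definition convergent (f : F -> F) := exists f', [/\ adjoint_pair f f',
  forall h, exists xi, tends f h xi & forall h, exists xi, tends f' h xi].

Lemma convergent_subalgebra : cstar_subalgebra [set f | convergent f].
Proof.
split=> /=.
- split; first by move=> f [f' [ff _ _]]; exists f'.
  exists (fun=> 0); split; try by move=> h; exists 0; exact: tends0.
  by move=> x y; rewrite ip0l (lin0 (ip_linr _)).
- move=> c f g [f' [ff f1 f2]] [g' [gg g1 g2]].
  exists (fun x => c^* *: f' x + g' x); split; first exact: adjoint_combination.
    move=> h; have [x hx] := f1 h; have [y hy] := g1 h.
    by exists (c *: x + y); exact: tends_combination.
  move=> h; have [x hx] := f2 h; have [y hy] := g2 h.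
  by exists (c^* *: x + y); exact: tends_combination.
- move=> f g [f' [ff f1 f2]] [g' [gg g1 g2]].
  exists (g' \o f'); split; first exact: adjoint_comp.
    move=> h; have [x hx] := g1 h; have [y hy] := f1 x.
    by exists y; exact: tends_comp ff hx hy.
  move=> h; have [x hx] := f2 h; have [y hy] := g2 x.
  by exists y; exact: tends_comp (adjoint_sym gg) hx hy.
- move=> f g [f' [ff f1 f2]] fg; rewrite (adjoint_unique fg ff).
  by exists f; split=> //; exact: adjoint_sym.
move=> f [f' ff] happ.
have real_app (e : R) : 0 < e -> exists2 g, convergent g &
    forall x, nm (f x - g x) <= e * nm x.
  move=> e0; have [|g hg hx] := happ e%:C%C; first by rewrite ltcR.
  by exists g => // x; have := hx x; rewrite !nmE -rmorphM lecR.
exists f'; split=> // h.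
  apply: (tends_limit ff) => e /real_app [g [g' [gg g1 _]] hg].
  by exists g, g'.
apply: (tends_limit (adjoint_sym ff)) => e e0.
(* Passing to adjoints multiplies the error by at most 4. *)
have [|g [g' [gg _ g2]] hg] := real_app (e / 4); first by rewrite divr_gt0.
exists g', g; split; [exact: adjoint_sym| |exact: g2].
have dd : adjoint_pair (fun x => f x - g x) (fun x => f' x - g' x).
  by move=> x y; rewrite ipBl ipBr ff gg.
move=> x; have := adjoint_norm_le _ dd hg x.
by rewrite [4 * _]mulrC divfK // => -> //; rewrite divr_ge0 // ltW.
Qed.

End WindowVectors.

(** * Adjoints of creation operators *)

Section HilbertTensors.
Variables (R : realType) (M : cstar_algebra R) (E : tensor_powers M).
Variables (H : hilbert R) (sigma : M -> H -> H).
Hypothesis hs : representation sigma.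
Variable K : hilbert_tensors E sigma.

Lemma nm_htens_le n (x : E n) h : nm (htens K x h) <= nm x * nm h.
Proof.
rewrite -(@ler_pXn2r _ 2) // ?nnegrE ?mulr_ge0 ?nm_ge0 //.
rewrite -Re_dot htens_dot; apply: le_trans (ler_norm _) _.
apply: le_trans (Re_le_nm _) _; apply: le_trans (cauchy_schwarz _ _) _.
apply: le_trans (ler_wpM2l (nm_ge0 h) (rep_contractive hs _ _)) _.
by rewrite nm_ip le_eqVlt; apply/orP; left; apply/eqP; ring.
Qed.

(* The adjoint of [h |-> z (x) h], which maps [y (x) h] to [sigma <z, y> h]. *)
Lemma htens_adjoint n (z : E n) (v : K n) :
  exists xi : H, forall h, dot xi h = dot v (htens K z h).
Proof.
(* The vectors [w] admitting such a [xi] form a closed subspace: by [PM] the vector [xi] is bounded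
   in terms of [w], so approximants of [w] give a Cauchy sequence in [H]. *)
pose P (w : K n) (xi : H) := forall h, dot xi h = dot w (htens K z h).
have PB w1 w2 x1 x2 : P w1 x1 -> P w2 x2 -> P (w1 - w2) (x1 - x2).
  by move=> h1 h2 h; rewrite !dotBl h1 h2.
have PM w x : P w x -> nm x <= nm z * nm w.
  move=> hx; have [x0|x0] := eqVneq (nm x) 0.
    by rewrite x0 mulr_ge0 // nm_ge0.
  have x_gt0 : 0 < nm x by rewrite lt_neqAle eq_sym x0 nm_ge0.
  rewrite -(ler_pM2r x_gt0) -expr2 -Re_dot hx.
  apply: le_trans (ler_norm _) _; apply: le_trans (Re_le_nm _) _.
  apply: le_trans (cauchy_schwarz _ _) _.
  apply: le_trans (ler_wpM2l (nm_ge0 w) (nm_htens_le z x)) _.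
  by rewrite mulrCA mulrA.
have : closed_span [set htens K x h | x in setT & h in setT] v.
  by rewrite htens_dense.
move: v; apply: closed_span_ind.
- by exists 0 => h; rewrite dot_conj dot0r dot_conj dot0r !conjC0.
- move=> c w1 w2 [x1 h1] [x2 h2]; exists (c *: x1 + x2) => h.
  by rewrite !dotDl !dotZl h1 h2.
- move=> v hv.
  pose e (j : nat) : R := j.+1%:R^-1.
  have e0 j : 0 < e j by rewrite invr_gt0 ltr0n.
  have [w hw] : {w : nat -> K n & forall j,
      (exists x, P (w j) x) /\ nm (v - w j) < e j}.
    apply: (@choice _ _ (fun j w => (exists x, P w x) /\ nm (v - w) < e j)) => j.
    by have [w Pw d] := hv _ (e0 j); exists w.
  have [x hx] : {x : nat -> H & forall j, P (w j) (x j)}.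
    by apply: (@choice _ _ (fun j x => P (w j) x)) => j; exact: (hw j).1.
  have small (d : R) : 0 < d -> exists N, forall j, (N <= j)%N -> nm z * e j < d.
    move=> d0; have [hn] := nullZ (nm z) (null_inv R).
    move/cvgrPdist_lt: hn => /(_ _ d0) [N _ hN]; exists N => j /hN /=.
    by rewrite sub0r normrN; apply: le_lt_trans; exact: ler_norm.
  have [l hl] : exists l : H, x @ \oo --> l.
    apply: nm_cauchy_cvg => d d0; have d2 : 0 < d / 2 by rewrite divr_gt0.
    have [N hN] := small _ d2; exists N => i j /hN hi /hN hj.
    apply: le_lt_trans (PM _ _ (PB _ _ _ _ (hx i) (hx j))) _.
    have : nm (w i - w j) <= e i + e j.
      rewrite -(subrKA v); apply: le_trans (nmD _ _) _; rewrite nmBC.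
      by apply: lerD; apply: ltW; exact: (hw _).2.
    move=> /(ler_wpM2l (nm_ge0 z)); rewrite mulrDr; lra.
  exists l => h; apply/eqP; rewrite -subr_eq0; apply/eqP.
  apply: (@nm_small0 _ _ _ (nm h + nm (htens K z h) + 1)).
    by rewrite ltr_wpDl // addr_ge0 // nm_ge0.
  move=> d d0; have [N1 hN1] := (cvg_nmP _ _).1 hl _ d0.
  have [N2 hN2] : exists N, forall j, (N <= j)%N -> e j < d.
    have [hn] := null_inv R.
    move/cvgrPdist_lt: hn => /(_ _ d0) [N _ hN]; exists N => j /hN /=.
    by rewrite sub0r normrN; apply: le_lt_trans; exact: ler_norm.
  pose j := maxn N1 N2.
  have h1 := hN1 j (leq_maxl _ _); have h2 := hN2 j (leq_maxr _ _).
  have h3 := lt_trans (hw j).2 h2.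
  have -> : dot l h - dot v (htens K z h) =
      dot (l - x j) h - dot (v - w j) (htens K z h).
    by rewrite !dotBl hx opprB addrA subrK.
  apply: le_trans (nmB _ _) _.
  have := cauchy_schwarz (l - x j) h.
  have := cauchy_schwarz (v - w j) (htens K z h).
  have := ler_wpM2r (nm_ge0 h) (ltW h1).
  have := ler_wpM2r (nm_ge0 (htens K z h)) (ltW h3).
  lra.
move=> _ [y _ [h _ <-]]; exists (sigma (ip z y) h) => g.
by rewrite htens_dot -[ip z y]ip_star (rep_adj hs).
Qed.

End HilbertTensors.

(** * The shift against the isometries W_k *)

Section Representation.
Variables (R : realType) (M : cstar_algebra R).
Variables (E : tensor_powers M) (X : forall n, set (E n)).
Variable p : forall n, E n -> E n.
Hypothesis hX : standard_subproduct_system X.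
Hypothesis hp : forall n, ortho_projection (@X n) (@p n).
Variables (F : hilbert_module M) (co : forall n, F -> E n).
Variable S : forall n, E n -> F -> F.
Hypothesis hF : fock_space X co.
Hypothesis hS : fock_shift X p co S.
Variables (H : hilbert R) (T : forall n, E n -> H -> H).
Arguments T : clear implicits.
Arguments p : clear implicits.
Arguments S : clear implicits.
Arguments X : clear implicits.
Hypothesis hT : cc_covariant_representation X p T.
Variable K : hilbert_tensors E (T 0%N : M -> H -> H).
Variables (Tt : forall n, K n -> H) (Ts : forall n, H -> K n).
Arguments Tt : clear implicits.
Arguments Ts : clear implicits.
Hypothesis hTt : tilde_maps X T Tt.
Hypothesis hTs : tilde_adjoints X Tt Ts.
Hypothesis hcoiso : coisometric Tt Ts.
Variable pI : forall n, K n -> K n.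
Arguments pI : clear implicits.
Hypothesis hpI : amplifications p pI.
Hypothesis hlim : forall (m : nat) (y : E m) (h : H), (0 < m)%N -> X m y ->
  (fun k : nat => `|pI (m + k)%N (hmul y (Ts k h))|) @ \oo --> `|T m y h|.

Local Notation sigma := (T 0%N : M -> H -> H).
Local Notation ev := (tev co K).
Local Notation A := (tsum F H).
Local Notation sub_ht k := (@sub_htensor _ _ _ _ X _ K k).
Implicit Types (h g : H) (u : A).

Let hs : representation sigma := cc_rep hT.

Lemma X_zero n : X n 0.
Proof. by have [_ _ /(_ n) [[X0 _] _ _ _] _] := hX. Qed.

Lemma proj_fix n x : X n x -> p n x = x.
Proof.
move=> Xx; have [Xp hpx] := hp x; apply/esym/eqP; rewrite -subr_eq0; apply/eqP.
apply/nm_eq0/eqP; rewrite -sqrf_eq0 -nm_ip; apply/eqP.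
rewrite hpx ?nm0 //; have [_ _ /(_ n) [[_ lX] _ _ _] _] := hX.
by rewrite addrC -scaleN1r; apply: lX.
Qed.

Lemma ev_sub k u : sub_ht k (ev k u).
Proof.
elim: u => [|a u ih]; first by rewrite /tev big_nil; exact: closed_span0.
rewrite /tev big_cons -[htens _ _ _]scale1r; apply: closed_spanP => //.
apply: closed_span_sub; exists (co k a.1); first exact: (fock_mem hF).
by exists a.2.
Qed.

(** Generators of X(k) (x) H are components of one-term formal sums, by [summand_exists]; this
    transfers estimates on formal sums to X(k) (x) H. *)
Lemma ev_approx k v (e : R) : sub_ht k v -> 0 < e ->
  exists2 u, homog co k u & nm (ev k u - v) < e.
Proof.
move=> hv; move: v hv e; apply: closed_span_ind.
- by move=> e e0; exists [::] => //; rewrite /tev big_nil subr0 nm0.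
- move=> c v w hv hw e e0; pose d := e / (nm c + 1).
  have c0 : 0 < nm c + 1 by rewrite ltr_wpDl // nm_ge0.
  have d0 : 0 < d by rewrite divr_gt0.
  have [u1 hu1 d1] := hv _ d0; have [u2 hu2 d2] := hw _ d0.
  exists (tscale c u1 ++ u2).
    by apply: (@homog_cat _ _ _ _ _ _ k) => //; exact: homog_scale.
  rewrite (evD co K) (evZ co K) opprD addrACA -scalerBr.
  apply: le_lt_trans (nmD _ _) _; rewrite nmZ.
  have -> : e = nm c * d + d by rewrite /d; field; rewrite gt_eqF.
  by apply: ler_ltD => //; rewrite ler_wpM2l ?nm_ge0 // ltW.
- move=> v hv e e0; have e2 : 0 < e / 2 by rewrite divr_gt0.
  have [w hw d1] := hv _ e2; have [u hu d2] := hw _ e2; exists u => //.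
  rewrite -(subrKA w); apply: le_lt_trans (nmD _ _) _.
  by rewrite [nm (w - v)]nmBC; lra.
move=> _ [x Xx [h _ <-]] e e0; have [y [cy1 cy2]] := summand_exists hF X_zero Xx.
exists [:: (y, h)]; last by rewrite /tev big_seq1 cy1 subrr nm0.
by move=> a; rewrite inE => /eqP ->.
Qed.

Lemma sub_htB k v w : sub_ht k v -> sub_ht k w -> sub_ht k (v - w).
Proof. by move=> hv hw; rewrite addrC -scaleN1r; exact: closed_spanP. Qed.

(** Extension by density. The Lipschitz bounds are asked only on [sub_ht k], since the values of
    [Tt k] elsewhere are arbitrary. *)
Lemma sub_ext k (V : normedZmodType R[i]) (f g : K k -> V) (C : R) : 0 < C ->
  (forall v w, sub_ht k v -> sub_ht k w -> nm (f v - f w) <= C * nm (v - w)) ->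
  (forall v w, sub_ht k v -> sub_ht k w -> nm (g v - g w) <= C * nm (v - w)) ->
  (forall u, homog co k u -> f (ev k u) = g (ev k u)) ->
  forall v, sub_ht k v -> f v = g v.
Proof.
move=> C0 hf hg fg v hv; apply/eqP; rewrite -subr_eq0; apply/eqP.
apply: (@nm_small0 _ _ _ (C + C)) => [|e e0]; first by rewrite addr_gt0.
have [u hu d] := ev_approx hv e0.
rewrite -(subrKA (f (ev k u))) {2}fg //; apply: le_trans (nmD _ _) _.
rewrite mulrDl; apply: lerD.
  by apply: le_trans (hf _ _ hv (@ev_sub k u)) _; rewrite ler_pM2l // nmBC ltW.
by apply: le_trans (hg _ _ (@ev_sub k u) hv) _; rewrite ler_pM2l // ltW.
Qed.

Lemma TtB k v w : sub_ht k v -> sub_ht k w -> Tt k (v - w) = Tt k v - Tt k w.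
Proof.
move=> hv hw; have [lin _ _] := hTt k.
by rewrite addrC -scaleN1r lin // scaleN1r addrC.
Qed.

Lemma nm_Tt k v : sub_ht k v -> nm (Tt k v) <= nm v.
Proof. by move=> hv; have [_ /(_ v hv) + _] := hTt k; rewrite !nmE lecR. Qed.

Lemma Tt_ev k u : Tt k (ev k u) = \sum_(a <- u) T k (co k a.1) a.2.
Proof.
have [lin _ gen] := hTt k.
elim: u => [|a u ih].
  rewrite /tev !big_nil; have s0 : sub_ht k 0 by exact: closed_span0.
  by have := TtB s0 s0; rewrite !subrr.
rewrite big_cons -ih /tev big_cons -[htens _ _ _]scale1r lin.
- by rewrite scale1r gen //; exact: (fock_mem hF).
- apply: closed_span_sub; exists (co k a.1); first exact: (fock_mem hF).
  by exists a.2.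
exact: ev_sub.
Qed.

Lemma Ts_sub k h : sub_ht k (Ts k h).
Proof. exact: (hTs k h).1. Qed.

Lemma Ts_Tt k h v : sub_ht k v -> dot (Ts k h) v = dot h (Tt k v).
Proof. exact: (hTs k h).2. Qed.

Lemma Ts_dot k h g : dot (Ts k h) (Ts k g) = dot h g.
Proof. by rewrite Ts_Tt ?hcoiso //; exact: Ts_sub. Qed.

Lemma nm_Ts k h : nm (Ts k h) = nm h.
Proof. exact: (nm_iso Ts_dot). Qed.

Lemma Ts_lin k : linear (Ts k).
Proof.
move=> c h g; apply/eqP; rewrite -subr_eq0; apply/eqP; set d := _ - _.
have hd : sub_ht k d.
  by apply: sub_htB; [|apply: closed_spanP]; exact: Ts_sub.
apply/nm_eq0/eqP; rewrite -sqrf_eq0 -Re_dot {1}/d dotBl dotDl dotZl !Ts_Tt //.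
by rewrite dotDl dotZl subrr.
Qed.

(** On X(k) (x) H this is [S_n(z) (x) I_H]; at [Ts k h] it is the vector in the limit hypothesis. *)
Definition shiftK n (z : E n) k (v : K k) : K (n + k)%N := pI (n + k)%N (hmul z v).

Section Shift.
Variables (n : nat) (z : E n).
Hypothesis Xz : X n z.

Lemma shiftK_lin k : linear (shiftK z (k := k)).
Proof.
by move=> c v w; rewrite /shiftK hmul_linear (proj1 (proj1 (hpI _))).
Qed.

Lemma shiftK_htens k (x : E k) h :
  shiftK z (htens K x h) = htens K (p _ (tens z x)) h.
Proof. by rewrite /shiftK hmul_htens (proj2 (hpI _)). Qed.

Lemma shift_summand k x : (forall l, l <> k -> co l x = 0) ->
  in_summand co (p _ (tens z (co k x))) (S n z x).
Proof.
move=> hx; have [_ h] := hS Xz; apply: h; first exact: (fock_mem hF).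
by split.
Qed.

Lemma homog_shift k u : homog co k u -> homog co (n + k)%N (tapp (S n z) u).
Proof.
move=> hu a /mapP [b bu ->] l lk /=.
by have [_] := shift_summand (hu b bu); apply.
Qed.

Lemma ev_shift k u : homog co k u ->
  ev (n + k)%N (tapp (S n z) u) = shiftK z (ev k u).
Proof.
move=> hu; rewrite /tev (lin_sum (@shiftK_lin k)) big_map.
apply: eq_big_seq => a au.
by rewrite shiftK_htens /= (proj1 (shift_summand (hu a au))).
Qed.

Lemma shiftK_bounded k :
  exists2 C : R, 0 < C & forall v : K k, nm (shiftK z v) <= C * nm v.
Proof.
have [C1 C10 h1] := bounded_of_continuous (@hmul_linear _ _ _ _ _ K n k z)
  (@hmul_continuous _ _ _ _ _ K n k z).
have [[lp cp] _] := hpI (n + k)%N.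
have [C2 C20 h2] := bounded_of_continuous lp cp.
exists (C2 * C1); first by rewrite mulr_gt0.
move=> v; apply: le_trans (h2 _) _; by rewrite -mulrA ler_pM2l.
Qed.

(* The bound is uniform in k, since it is that of S_n(z) on the Fock space. *)
Lemma shiftK_uniform : exists2 c : R, 0 < c &
  forall k v, sub_ht k v -> nm (shiftK z v) <= c * nm v.
Proof.
have [[f' ff] _] := hS Xz; have [C C0 hC] := Q_app_bounded hF hs K ff.
have c0 : 0 < Num.sqrt C by rewrite sqrtr_gt0.
(* [D] depends on [k], but it multiplies only the error of approximating [v] by a formal sum. *)
exists (Num.sqrt C) => // k v hv; have [D D0 hD] := shiftK_bounded k.
apply/ler_addgt0Pr => e e0; pose d := e / (Num.sqrt C + D).
have d0 : 0 < d by rewrite divr_gt0 // addr_gt0.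
have [u hu hd] := ev_approx hv d0.
have h1 : nm (shiftK z (ev k u)) <= Num.sqrt C * nm (ev k u).
  rewrite -(@ler_pXn2r _ 2) // ?nnegrE ?mulr_ge0 ?nm_ge0 ?(ltW c0) //.
  rewrite exprMn sqr_sqrtr ?(ltW C0) // -(ev_shift hu).
  by rewrite -(Q_homog hF K (homog_shift hu)) -(Q_homog hF K hu).
have h2 : nm (shiftK z (v - ev k u)) <= D * d.
  by apply: le_trans (hD _) _; rewrite ler_pM2l // nmBC ltW.
have h3 : nm (ev k u) <= nm v + d.
  rewrite -[ev k u](subrK v) addrC; apply: le_trans (nmD _ _) _.
  by rewrite lerD2l ltW.
rewrite -[v in leLHS](subrK (ev k u)) (linD (@shiftK_lin k)).
apply: le_trans (nmD _ _) _.
have -> : e = Num.sqrt C * d + D * d.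
  by rewrite -mulrDl /d mulrC divfK // gt_eqF // addr_gt0.
have := ler_wpM2l (ltW c0) h3; rewrite mulrDr; lra.
Qed.

Lemma shiftK_sub k v : sub_ht k v -> sub_ht (n + k)%N (shiftK z v).
Proof.
move=> hv; have [D D0 hD] := shiftK_bounded k.
apply: closed_span_approx => e e0; have [u hu d] := ev_approx hv (divr_gt0 e0 D0).
exists (shiftK z (ev k u)); first by rewrite -(ev_shift hu); exact: ev_sub.
rewrite -(linB (@shiftK_lin k)); apply: le_lt_trans (hD _) _.
by rewrite nmBC mulrC -ltr_pdivlMr.
Qed.

Lemma T_bounded : exists2 C : R, 0 < C & forall h, nm (T n z h) <= C * nm h.
Proof. by have [lT cT] := cc_bounded hT Xz; exact: bounded_of_continuous. Qed.

Lemma T_lin : linear (T n z).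
Proof. by have [] := cc_bounded hT Xz. Qed.

(** On generators this is the multiplicativity of [T]; its adjoint form is S_n(z)^* W_(n+k) = W_k
    T_n(z)^*. *)
Lemma Tt_shiftK k v : sub_ht k v ->
  Tt (n + k)%N (shiftK z v) = T n z (Tt k v).
Proof.
have [C C0 hC] := T_bounded; have [D D0 hD] := shiftK_bounded k.
move: v; apply: (@sub_ext k _ (fun v => Tt (n + k)%N (shiftK z v))
  (fun v => T n z (Tt k v)) (C + D)); first by rewrite addr_gt0.
- move=> v w hv hw; rewrite -TtB; [|exact: shiftK_sub|exact: shiftK_sub].
  rewrite -(linB (@shiftK_lin k)).
  have svw : sub_ht (n + k)%N (shiftK z (v - w)) by apply: shiftK_sub; exact: sub_htB.
  apply: le_trans (nm_Tt svw) _.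
  by apply: le_trans (hD _) _; rewrite ler_wpM2r ?nm_ge0 // lerDr ltW.
- move=> v w hv hw; rewrite -(linB T_lin) -TtB //.
  apply: le_trans (hC _) _; have svw : sub_ht k (v - w) by exact: sub_htB.
  apply: le_trans (ler_wpM2l (ltW C0) (nm_Tt svw)) _.
  by rewrite ler_wpM2r ?nm_ge0 // lerDl ltW.
move=> u hu; rewrite -(ev_shift hu) !Tt_ev (lin_sum T_lin) big_map.
apply: eq_big_seq => a au; rewrite (proj1 (shift_summand (hu a au))).
by rewrite (cc_mul hT) //; exact: (fock_mem hF).
Qed.

(** Pythagoras: T~_(n+k) sends S_n(z) W_k h to T_n(z) h, because T~_k W_k is the identity, so the
    cross term is [|T_n(z) h|^2]. *)
Lemma nm_shiftK_Ts k h :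
  nm (shiftK z (Ts k h) - Ts (n + k)%N (T n z h)) ^+ 2 =
  nm (shiftK z (Ts k h)) ^+ 2 - nm (T n z h) ^+ 2.
Proof.
rewrite nm_sqrB nm_Ts dot_conj Re_conj Ts_Tt; last first.
  by apply: shiftK_sub; exact: Ts_sub.
rewrite Tt_shiftK ?hcoiso ?Re_dot; last exact: Ts_sub.
ring.
Qed.

End Shift.

(** Prepares degree 0, which the limit hypothesis does not cover: there the shift is the left action
    of [a], whose adjoint is the action of [astar a]. The types match because [0 + k] computes to
    [k]. *)
Lemma shiftK_scalar_adjoint (a : M) k (v w : K k) : sub_ht k v -> sub_ht k w ->
  dot (shiftK (a : E 0) v : K k) w = dot v (shiftK (astar a : E 0) w : K k).
Proof.
have X0a b : X 0%N (b : M) by have [-> _ _ _] := hX.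
have gen (b : M) (x : E k) h : X k x ->
    (shiftK (b : E 0) (htens K x h) : K k) = htens K (lact b x) h.
  move=> Xx; rewrite shiftK_htens /tens tmul0l proj_fix //.
  by have [_ _ /(_ k) [_ _ _ lX] _] := hX; apply: lX.
have lin (b : M) : linear (fun x : K k => shiftK (b : E 0) x : K k).
  exact: (@shiftK_lin 0 b k).
have bnd (b : M) := @shiftK_bounded 0 b k.
have [C1 C10 h1] := bnd a; have [C2 C20 h2] := bnd (astar a).
move=> hv hw.
move: v hv; apply: closed_span_ind.
- by rewrite (lin0 (lin a)) dot_conj dot0r dot_conj dot0r !conjC0.
- by move=> c x y ex ey; rewrite lin !dotDl !dotZl ex ey.
- move=> v hv; apply/eqP; rewrite -subr_eq0; apply/eqP.
  apply: (@nm_small0 _ _ _ (C1 * nm w + C2 * nm w + 1)).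
    by rewrite ltr_wpDl // addr_ge0 // mulr_ge0 ?nm_ge0 // ltW.
  move=> e e0; have [x ex d] := hv _ e0.
  have -> : dot (shiftK (a : E 0) v : K k) w - dot v (shiftK (astar a : E 0) w : K k)
     = dot (shiftK (a : E 0) (v - x) : K k) w
       - dot (v - x) (shiftK (astar a : E 0) w : K k).
    by rewrite (linB (lin a)) !dotBl ex opprB addrA subrK.
  apply: le_trans (nmB _ _) _; rewrite mulrDl mul1r mulrDl.
  apply: (@le_trans _ _ (C1 * nm w * e + C2 * nm w * e)); last by rewrite lerDl ltW.
  apply: lerD; apply: le_trans (cauchy_schwarz _ _) _.
    rewrite mulrAC ler_wpM2r ?nm_ge0 //; apply: le_trans (h1 _) _.
    by rewrite ler_pM2l // ltW.
  rewrite mulrC; by apply: ler_pM; rewrite ?nm_ge0 // ltW.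
move=> _ [x Xx [h _ <-]]; rewrite gen //.
move: w hw; apply: closed_span_ind.
- by rewrite (lin0 (lin _)) !dot0r.
- by move=> c y y' ey ey'; rewrite lin !dotDr !dotZr ey ey'.
- move=> w hw; apply/eqP; rewrite -subr_eq0; apply/eqP.
  set x1 := htens K (lact a x) h; set x2 := htens K x h.
  apply: (@nm_small0 _ _ _ (nm x1 + nm x2 * C2 + 1)).
    by rewrite ltr_wpDl // addr_ge0 ?mulr_ge0 ?nm_ge0 // ltW.
  move=> e e0; have [y ey d] := hw _ e0.
  have -> : dot x1 w - dot x2 (shiftK (astar a : E 0) w : K k)
     = dot x1 (w - y) - dot x2 (shiftK (astar a : E 0) (w - y) : K k).
    by rewrite (linB (lin _)) !dotBr ey opprB addrA subrK.
  apply: le_trans (nmB _ _) _; rewrite mulrDl mul1r mulrDl.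
  apply: (@le_trans _ _ (nm x1 * e + nm x2 * C2 * e)); last by rewrite lerDl ltW.
  apply: lerD; apply: le_trans (cauchy_schwarz _ _) _.
    by rewrite ler_wpM2l ?nm_ge0 // ltW.
  rewrite -mulrA ler_wpM2l ?nm_ge0 //; apply: le_trans (h2 _) _.
  by rewrite ler_pM2l // ltW.
move=> _ [y Xy [g _ <-]]; rewrite gen // !htens_dot.
by rewrite (@lact_star _ _ (E k) a).
Qed.

(** <a W_k h, a W_k h> = <W_k h, a^* a W_k h> = <h, sigma(a^* a) h>, so in degree 0 the identity
    holds for every [k], without a limit. *)
Lemma nm_shiftK_scalar (a : M) k h :
  nm (shiftK (a : E 0) (Ts k h)) ^+ 2 = nm (sigma a h) ^+ 2.
Proof.
have X0a b : X 0%N (b : M) by have [-> _ _ _] := hX.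
have sTs := @Ts_sub k h.
have s1 : sub_ht k (shiftK (a : E 0) (Ts k h)) := shiftK_sub (X0a a) sTs.
rewrite -!Re_dot; congr complex.Re.
have := @shiftK_scalar_adjoint a k _ _ sTs s1; rewrite /= => ->.
have s2 : sub_ht k (shiftK (astar a : E 0) (shiftK (a : E 0) (Ts k h) : K k)) :=
  shiftK_sub (X0a _) s1.
rewrite Ts_Tt //.
have := @Tt_shiftK 0 (astar a) (X0a _) k _ s1; rewrite /= => ->.
have := @Tt_shiftK 0 a (X0a _) k _ sTs; rewrite /= => ->.
by rewrite hcoiso -(rep_adj hs) astarK.
Qed.

(** The limit hypothesis enters here, through [nm_shiftK_Ts], for positive [n]. *)
Lemma null_shiftK n (z : E n) h : X n z ->
  null (fun k => nm (shiftK z (Ts k h) - Ts (n + k)%N (T n z h))).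
Proof.
move=> Xz; have e : (fun k => nm (shiftK z (Ts k h) - Ts (n + k)%N (T n z h))) =
   (fun k => Num.sqrt (nm (shiftK z (Ts k h)) ^+ 2 - nm (T n z h) ^+ 2)).
  by apply/funext => k; rewrite -(nm_shiftK_Ts Xz) sqrtr_sqr ger0_norm // nm_ge0.
rewrite e; apply: null_sqrt; constructor.
case: n z Xz {e} => [|n] z Xz.
  by under eq_fun do rewrite (nm_shiftK_scalar z) subrr; exact: cvg_cst.
have hl : (fun k => nm (shiftK z (Ts k h))) @ \oo --> nm (T n.+1 z h).
  apply/cvgrPdist_lt => e e0; have /cvgrPdist_lt := @hlim n.+1 z h isT Xz.
  move=> /(_ e%:C%C) []; first by rewrite ltcR.
  move=> N _ hN; exists N => // k /hN /=.
  by rewrite (nmE (T n.+1 z h)) (nmE (pI _ (hmul z (Ts k h)))) -rmorphB nm_lt nmR.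
rewrite -(subrr (nm (T n.+1 z h) ^+ 2)); apply: cvgB; last exact: cvg_cst.
by under eq_fun do rewrite expr2; rewrite expr2; exact: cvgM.
Qed.

(** * The generators of the Toeplitz algebra on window sums *)

Variable om : nat -> H -> A.
Hypothesis om_homog : forall k h, homog co k (om k h).
Hypothesis om_close : forall k h, nm (ev k (om k h) - Ts k h) <= k.+1%:R^-1.
Local Notation tends := (tends sigma om).

Lemma asym_shift n h : asym sigma (window (fun k => om (n + k)%N h)) (wvec om h).
Proof.
apply: (@asym_window_shift _ _ _ _ _ _ hF _ _ hs K (fun k => om k h) ((nm h + 1) ^+ 2)).
  by move=> k; exact: om_homog.
by move=> k; exact: (Q_om_le hF Ts_dot om_homog om_close).
Qed.

Lemma app_window f (a : nat -> A) N :
  tapp f (window a N) = window (fun k => tapp f (a k)) N.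
Proof. by rewrite /window /tapp map_flatten -map_comp. Qed.

(** [S n z] moves the term of degree [k] to degree [n + k], so the image is compared termwise with
    the window shifted by [n], which [asym_shift] moves back. *)
Lemma tends_shift n (z : E n) h : X n z -> tends (S n z) h (T n z h).
Proof.
move=> Xz; apply: (asym_trans hF hs K _ (asym_shift n (T n z h))).
apply: (@asym_windows _ _ _ _ _ _ hF _ _ hs K (addn n)
  (fun k => tapp (S n z) (om k h)) (fun k => om (n + k)%N (T n z h))).
- exact: addnI.
- by move=> N w; rewrite app_window represents_window.
- exact: represents_window.
- by move=> k; apply: (homog_shift Xz); exact: om_homog.
- by move=> k; exact: om_homog.
have [c c0 hc] := shiftK_uniform Xz.
apply: (@null_approx _ _ _ _ _ _ hF _ _ hs K (addn n) _ _
  (fun k => shiftK z (Ts k h)) (fun k => Ts (n + k)%N (T n z h))).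
- by move=> k; apply: (homog_shift Xz); exact: om_homog.
- by move=> k; exact: om_homog.
- apply: null_le (nullZ c (null_close om_close h)) => k; rewrite nm_ge0 /=.
  rewrite (ev_shift Xz (@om_homog k h)) -(linB (@shiftK_lin n z k)).
  by apply: hc; apply: sub_htB; [exact: ev_sub|exact: Ts_sub].
- have := null_shift n (null_close om_close (T n z h)); exact.
exact: null_shiftK.
Qed.

(** The component of [f' b] in degree [l] is paired with itself; moving [f'] across pairs a vector
    of degree [n + l] with one of degree [n + k]. *)
Lemma homog_adjoint n (z : E n) f' k u : X n z -> adjoint_pair (S n z) f' ->
  homog co (n + k)%N u -> homog co k (tapp f' u).
Proof.
move=> Xz ff hu a /mapP [b bu ->] l lk /=.
have Xy : X l (co l (f' b.1)) by exact: (fock_mem hF).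
have [x [cx1 cx2]] := summand_exists hF X_zero Xy.
apply/nm_eq0/eqP; rewrite -sqrf_eq0 -nm_ip; apply/eqP.
rewrite -{1}cx1 -(summand_ip hF _ cx2) -ff.
have [s1 s2] := shift_summand Xz cx2.
have nl : (n + k)%N <> (n + l)%N by move/addnI => kl; exact: lk.
by rewrite -ip_star (summand_ip hF _ (hu b bu)) s2 // -ip_star ip0l !astar0 nm0.
Qed.

Lemma tends_shift_adjoint n (z : E n) f' h : X n z -> adjoint_pair (S n z) f' ->
  exists xi, tends f' h xi.
Proof.
(* [xi] is T_n(z)^* h: as T_n(z) g = T~_n (z (x) g), it is the adjoint of g |-> z (x) g applied to
   W_n h. *)
move=> Xz ff; have [xi hxi] := htens_adjoint hs z (Ts n h).
have xiT g : dot xi g = dot h (T n z g).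
  have [_ _ gen] := hTt n.
  rewrite hxi Ts_Tt ?gen //; apply: closed_span_sub; exists z => //; by exists g.
exists xi.
have f'f := adjoint_sym ff.
(* The window is first shifted by [n], so that [f'], which lowers degrees by [n], brings its terms
   to the degrees [k] of the target. *)
apply: (asym_trans hF hs K (asym_app hF hs K f'f (asym_sym hs (asym_shift n h)))).
have h1 k : homog co k (tapp f' (om (n + k)%N h)).
  by apply: (homog_adjoint Xz ff); exact: om_homog.
apply: (@asym_windows _ _ _ _ _ _ hF _ _ hs K id
  (fun k => tapp f' (om (n + k)%N h)) (fun k => om k xi)) => //.
- by move=> N w; rewrite app_window represents_window.
- exact: represents_window.
have [c c0 hc] := shiftK_uniform Xz.
apply: (@null_approx _ _ _ _ _ _ hF _ _ hs K id _ _
  (fun k => ev k (tapp f' (om (n + k)%N h))) (fun k => Ts k xi)) => //.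
- by constructor; under eq_fun do rewrite subrr nm0; exact: cvg_cst.
- exact: null_close.
apply: null_le (nullZ c (null_shift n (null_close om_close h))) => k.
rewrite nm_ge0 /=; set d := ev k _ - _; set de := ev (n + k)%N _ - _.
have hd : sub_ht k d by apply: sub_htB; [exact: ev_sub|exact: Ts_sub].
(* [d] is S_n(z)^* applied to the error [de] of [om]: the exact parts cancel by [Tt_shiftK]. Testing
   with [w = d] then gives [nm d <= c * nm de], with [c] independent of [k]. *)
have key w : sub_ht k w -> dot d w = dot de (shiftK z w).
  have [D D0 hD] := shiftK_bounded z k.
  move: w; apply: (@sub_ext k _ (dot d) (fun w => dot de (shiftK z w))
    (nm d + nm de * D + 1)).
  - by rewrite ltr_wpDl // addr_ge0 ?mulr_ge0 ?nm_ge0 // ltW.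
  - move=> v w _ _; rewrite -dotBr; apply: le_trans (cauchy_schwarz _ _) _.
    rewrite ler_wpM2r ?nm_ge0 // -addrA lerDl addr_ge0 // mulr_ge0 ?nm_ge0 //.
    exact: ltW.
  - move=> v w _ _; rewrite -dotBr -(linB (@shiftK_lin n z k)).
    apply: le_trans (cauchy_schwarz _ _) _.
    apply: le_trans (ler_wpM2l (nm_ge0 _) (hD _)) _.
    by rewrite mulrA ler_wpM2r ?nm_ge0 // addrAC addrC lerDl addr_ge0 // nm_ge0.
  move=> u hu; rewrite /d /de !dotBl -(form_homog hF K _ (h1 k)).
  rewrite (form_app _ _ _ f'f) (form_homog hF K _ (@om_homog (n + k)%N h)).
  rewrite (ev_shift Xz hu); congr (_ - _).
  have su := @ev_sub k u.
  have szu : sub_ht (n + k)%N (shiftK z (ev k u)) by apply: shiftK_sub.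
  by rewrite (@Ts_Tt k xi _ su) (@Ts_Tt _ h _ szu) (@Tt_shiftK _ _ Xz _ _ su) xiT.
have [d0|d0] := eqVneq (nm d) 0; first by rewrite d0 mulr_ge0 ?nm_ge0 // ltW.
have d_gt0 : 0 < nm d by rewrite lt_neqAle eq_sym d0 nm_ge0.
rewrite -(ler_pM2r d_gt0) -expr2 -Re_dot key //.
apply: le_trans (ler_norm _) _; apply: le_trans (Re_le_nm _) _.
apply: le_trans (cauchy_schwarz _ _) _.
apply: le_trans (ler_wpM2l (nm_ge0 _) (hc _ _ hd)) _.
by rewrite mulrA [c * _]mulrC.
Qed.

Lemma toeplitz_convergent f : toeplitz_algebra X S f -> convergent sigma om f.
Proof.
move=> hf; apply: (hf [set f | convergent sigma om f]); split=> /=.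
  exact: (convergent_subalgebra hF hs Ts_lin Ts_dot om_homog om_close).
move=> _ [n [z [Xz ->]]]; have [[f' ff] _] := hS Xz.
exists f'; split=> // h; first by exists (T n z h); exact: tends_shift.
exact: (tends_shift_adjoint h Xz ff).
Qed.

(** * Construction of the representation *)

Lemma extension_exists : exists pi : (F -> F) -> H -> H,
  operator_representation (toeplitz_algebra X S) pi /\
  forall n (z : E n), X n z -> pi (S n z) = T n z.
Proof.
(* The default 0 is taken only where no limit exists, which does not occur on the Toeplitz
   algebra. *)
pose pi (f : F -> F) h : H := xget 0 [set xi | tends f h xi].
have uniq f h xi eta := @tends_unique _ _ _ _ _ _ hF _ _ hs K Ts Ts_dot om
  om_homog om_close f h xi eta.
have piP f h : toeplitz_algebra X S f -> tends f h (pi f h).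
  move=> /toeplitz_convergent [_ [_ hf _]].
  apply: (@xgetPex _ _ [set xi | tends f h xi]).
  exact: hf.
have piE f h xi : tends f h xi -> pi f h = xi.
  move=> hx; apply: (uniq f h _ _ _ hx).
  by apply: (@xgetPex _ _ [set xi | tends f h xi]); exists xi.
have piS n z : X n z -> pi (S n z) = T n z.
  by move=> Xz; apply/funext => h; apply: piE; exact: tends_shift.
exists pi; split=> //.
have gen n z : X n z -> toeplitz_algebra X S (S n z).
  by move=> Xz W [_ SW]; apply: SW; exists n, z.
have adjo f : toeplitz_algebra X S f -> exists g : F -> F, adjoint_pair f g.
  by move=> /toeplitz_convergent [g [fg _ _]]; exists g.
split.
- move=> f Df; have [g fg] := adjo f Df.
  have lpi : linear (pi f).
    move=> c h k; apply: piE.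
    exact: (tends_lin hF hs Ts_lin om_homog om_close c fg (piP _ h Df) (piP _ k Df)).
  split=> //; have [C C0 hC] := Q_app_bounded hF hs K fg.
  apply: (@continuous_of_bounded _ _ _ _ (Num.sqrt (2 * C))) => //.
    by rewrite sqrtr_gt0 mulr_gt0.
  move=> h; rewrite -(@ler_pXn2r _ 2) // ?nnegrE ?mulr_ge0 ?nm_ge0 ?sqrtr_ge0 //.
  rewrite exprMn sqr_sqrtr ?mulr_ge0 ?(ltW C0) //.
  exact: (tends_bounded hF hs Ts_dot om_homog om_close C0 hC (piP _ h Df)).
- move=> c f g h Df Dg; apply: piE.
  exact: (tends_combination hF hs Ts_lin om_homog om_close c (piP _ h Df) (piP _ h Dg)).
- move=> f g h Df Dg; apply: piE; have [f' ff] := adjo f Df.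
  exact: (tends_comp hF hs K ff (piP _ _ Dg) (piP _ _ Df)).
- move=> f g h k Df Dg fg.
  exact: (tends_adjoint hF hs Ts_lin Ts_dot om_homog om_close (adjoint_sym fg)
    (piP _ _ Dg) (piP _ _ Df)).
(* Nondegeneracy is inherited from [sigma], since [pi (S 0 a)] is [sigma a]. *)
have := rep_nondegenerate hs; rewrite -subTset => nd.
apply/seteqP; split=> // v _.
have := nd v I => + W [sW SW]; apply; split=> //.
move=> _ [a _ [h _ <-]]; apply: SW.
have Xa : X 0%N (a : E 0) by have [-> _ _ _] := hX.
by exists (S 0%N a); [exact: gen|exists h => //; rewrite piS].
Qed.

End Representation.

Unset Implicit Arguments.

Theorem theorem4p3 (R : realType) (M : cstar_algebra R)
  (E : tensor_powers M) (X : forall n, set (E n))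
  (p : forall n, E n -> E n)
  (hX : standard_subproduct_system X)
  (hp : forall n, ortho_projection (X n) (p n))
  (F : hilbert_module M) (co : forall n, F -> E n)
  (S : forall n, E n -> F -> F)
  (hF : fock_space X co) (hS : fock_shift X p co S)
  (H : hilbert R) (T : forall n, E n -> H -> H)
  (hT : cc_covariant_representation X p T)
  (K : hilbert_tensors E (T 0%N : M -> H -> H))
  (Tt : forall n, K n -> H) (Ts : forall n, H -> K n)
  (hTt : tilde_maps X T Tt) (hTs : tilde_adjoints X Tt Ts)
  (hcoiso : coisometric Tt Ts)
  (pI : forall n, K n -> K n) (hpI : amplifications p pI)
  (* the limit condition, with l = m + k *)
  (hlim : forall (m : nat) (y : E m) (h : H), (0 < m)%N -> X m y ->
     (fun k : nat => `|pI (m + k)%N (hmul y (Ts k h))|) @ \oo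
       --> `|T m y h|) :
  exists pi : (F -> F) -> H -> H,
    operator_representation (toeplitz_algebra X S) pi /\
    forall n (z : E n), X n z -> pi (S n z) = T n z.
Proof.
(* One choice over all pairs of a degree and a vector; the accuracy depends on the degree alone. *)
have [om hom] : {om : nat * H -> tsum F H & forall kh,
    homog co kh.1 (om kh) /\
    nm (tev co K kh.1 (om kh) - Ts kh.1 kh.2) <= kh.1.+1%:R^-1}.
  apply: (@choice _ _ (fun kh u => homog co kh.1 u /\
    nm (tev co K kh.1 u - Ts kh.1 kh.2) <= kh.1.+1%:R^-1)) => -[k h] /=.
  have e0 : (0 : R) < k.+1%:R^-1 by rewrite invr_gt0 ltr0n.
  have [u hu d] := ev_approx hX hF (hTs k h).1 e0.
  by exists u => //; split=> //; exact: ltW.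
exact: (extension_exists hX hp hF hS hT hTt hTs hcoiso hpI hlim
  (fun k h => (hom (k, h)).1) (fun k h => (hom (k, h)).2)).
Qed.
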